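(* Let $\mu$ be a finite measure, let $E$ be a Banach space which contains a closed subspace isomorphic to $c_0$, and let $Q: L^1(\mu)\to E$ be a surjective bounded linear operator. Then $\ker Q$ is not complemented in its second dual $(\ker Q)^{**}$; that is, there is no bounded linear projection of $(\ker Q)^{**}$ onto the canonical image of $\ker Q$.
   Context: A Banach space is identified with its canonical image in its second dual. A ''surjection'' between Banach spaces is a surjective bounded linear operator; ''isomorphic'' means linearly homeomorphic. $L^1(\mu)$ is the space of (classes of) $\mu$-integrable scalar functions with the usual norm. *)

(* Defs.v *)
From HB Require Import structures.
From mathcomp Require Import all_boot all_order all_algebra generic_quotient.
From mathcomp Require Import ring_quotient complex.
From mathcomp Require Import all_classical all_reals all_analysis.
From mathcomp Require Import measurable_realfun.

Set Implicit Arguments.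
Unset Strict Implicit.
Unset Printing Implicit Defensive.

Import Order.TTheory GRing.Theory Num.Theory.
Import numFieldNormedType.Exports.

Local Open Scope classical_set_scope.
Local Open Scope ring_scope.
Local Open Scope quotient_scope.

(* Banach spaces are taken over the reals or over the complex numbers; [scalars]
   covers both cases at once. *)
Variant scalar_kind := RealScalars | ComplexScalars.

Definition scalars (R : realType) (k : scalar_kind) : numFieldType :=
  match k with RealScalars => R | ComplexScalars => R[i] end.

Section Scalars.
Context {R : realType} {k : scalar_kind}.
Local Notation K := (scalars R k).

Definition re : K -> R :=
  match k return scalars R k -> R with
  | RealScalars => id
  | ComplexScalars => @complex.Re R
  end.

Definition im : K -> R :=
  match k return scalars R k -> R with
  | RealScalars => fun=> 0
  | ComplexScalars => @complex.Im R
  end.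

Definition of_real : R -> K :=
  match k return R -> scalars R k with
  | RealScalars => id
  | ComplexScalars => fun x => Complex x 0
  end.

Lemma of_realD x y : of_real (x + y) = of_real x + of_real y.
Proof. by rewrite /of_real; case: k => //=; rewrite -(rmorphD (real_complex R)). Qed.

Lemma of_realM x y : of_real (x * y) = of_real x * of_real y.
Proof. by rewrite /of_real; case: k => //=; rewrite -(rmorphM (real_complex R)). Qed.

Lemma of_real0 : of_real 0 = 0.
Proof. by rewrite /of_real; case: k. Qed.

Lemma ler_of_real x y : (of_real x <= of_real y) = (x <= y).
Proof. by rewrite /of_real; case: k => //=; rewrite lecR. Qed.

Lemma of_realK x : re (of_real x) = x.
Proof. by rewrite /of_real /re; case: k. Qed.

Lemma ge0_reK (z : K) : 0 <= z -> of_real (re z) = z.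
Proof.
rewrite /of_real /re; case: k z => //= -[a b] /=.
by rewrite lecE /= => /andP[/eqP -> _].
Qed.

Lemma reD (x y : K) : re (x + y) = re x + re y.
Proof. by rewrite /re; case: k x y => //= -[a b] [c d]. Qed.

Lemma imD (x y : K) : im (x + y) = im x + im y.
Proof. by rewrite /im; case: k x y => //= [*|[a b] [c d]] //; rewrite addr0. Qed.

Lemma reM (x y : K) : re (x * y) = re x * re y - im x * im y.
Proof.
by rewrite /re /im; case: k x y => //= [x y|[a b] [c d]] //; rewrite mul0r subr0.
Qed.

Lemma imM (x y : K) : im (x * y) = re x * im y + im x * re y.
Proof.
rewrite /re /im; case: k x y => //= [x y|[a b] [c d]] //=.
by rewrite mulr0 mul0r addr0.
Qed.

Lemma re0 : re 0 = 0. Proof. by rewrite /re; case: k. Qed.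

Lemma im0 : im 0 = 0. Proof. by rewrite /im; case: k. Qed.

Lemma re_norm (x : K) : re `|x| = Num.sqrt (re x ^+ 2 + im x ^+ 2).
Proof.
rewrite /re /im; case: k x => //= [x|[a b]] //=.
by rewrite expr0n addr0 sqrtr_sqr.
Qed.

Lemma of_real_re_norm (x : K) : of_real (re `|x|) = `|x|.
Proof. exact: ge0_reK. Qed.

Lemma ler_re (x y : K) : x <= y -> re x <= re y.
Proof.
rewrite /re; case: k x y => //= -[a b] [c d].
by rewrite lecE /= => /andP[].
Qed.

End Scalars.

Section SupNorm.
Context {R : realType} {k : scalar_kind} {I : Type}.
Local Notation K := (scalars R k).
Implicit Types (A : set I) (f g : I -> K).

(* The norm of a normed module over K takes its values in K, so a norm given by
   a real number (a supremum or an integral) is sent to K by [of_real]. *)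
Definition supnorm A f : K := of_real (sup [set re `|f i| | i in A]).

Definition bounded_on A f := exists M, forall i, A i -> `|f i| <= M.

Lemma ler_supnorm A f i : bounded_on A f -> A i -> `|f i| <= supnorm A f.
Proof.
move=> [M fM] Ai; rewrite -[leLHS]of_real_re_norm ler_of_real.
apply: ub_le_sup; last by exists i.
by exists (re M) => _ [j Aj <-]; exact/ler_re/fM.
Qed.

Lemma supnorm_le A f M : A !=set0 -> (forall i, A i -> `|f i| <= M) ->
  supnorm A f <= M.
Proof.
move=> [i0 Ai0] fM; have M0 : 0 <= M by apply: le_trans (fM _ Ai0).
rewrite -[leRHS]ge0_reK// ler_of_real; apply: ge_sup.
  by exists (re `|f i0|), i0.
by move=> _ [j Aj <-]; exact/ler_re/fM.
Qed.

Lemma supnorm_ge0 A f : A !=set0 -> bounded_on A f -> 0 <= supnorm A f.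
Proof. by move=> [i Ai] /ler_supnorm/(_ Ai); exact: le_trans. Qed.

Lemma supnormD A f g : A !=set0 -> bounded_on A f -> bounded_on A g ->
  supnorm A (fun i => f i + g i) <= supnorm A f + supnorm A g.
Proof.
move=> A0 bf bg; apply: supnorm_le => // i Ai.
by rewrite (le_trans (ler_normD _ _))// lerD// ler_supnorm.
Qed.

Lemma supnormZ A f (l : K) : A !=set0 -> bounded_on A f ->
  supnorm A (fun i => l * f i) = `|l| * supnorm A f.
Proof.
move=> A0 bf.
have lf i : A i -> `|l * f i| <= `|l| * supnorm A f.
  by move=> Ai; rewrite normrM ler_wpM2l// ler_supnorm.
apply/eqP; rewrite eq_le supnorm_le//=.
have blf : bounded_on A (fun i => l * f i) by exists (`|l| * supnorm A f).
have [->|l0] := eqVneq l 0.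
  rewrite normr0 mul0r supnorm_ge0//.
  by exists 0 => i _; rewrite mul0r normr0.
rewrite -ler_pdivlMl ?normr_gt0//; apply: supnorm_le => // i Ai.
by rewrite ler_pdivlMl ?normr_gt0// -normrM (ler_supnorm blf).
Qed.

Lemma supnorm_eq0 A f : bounded_on A f -> supnorm A f = 0 ->
  forall i, A i -> f i = 0.
Proof.
move=> bf f0 i Ai; apply/eqP; rewrite -normr_le0 -f0.
exact: ler_supnorm.
Qed.

End SupNorm.

Section Subspaces.
Context {K : numFieldType}.

Record linear_subspace (V : lmodType K) := LinearSubspace {
  subspace_pred :> {pred V};
  subspaceP : submod_closed subspace_pred
}.

End Subspaces.

Section SubspaceType.
Context {K : numFieldType} {V : normedModType K}.

HB.instance Definition _ (S : linear_subspace V) :=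
  GRing.isSubmodClosed.Build K V (subspace_pred S) (subspaceP S).

Record subspace_type (S : linear_subspace V) := SubspaceType {
  subspace_val :> V;
  subspace_valP : subspace_val \in subspace_pred S
}.

Variable S : linear_subspace V.

HB.instance Definition _ := [isSub for @subspace_val S].
HB.instance Definition _ := [Choice of subspace_type S by <:].
HB.instance Definition _ :=
  [SubChoice_isSubLmodule of subspace_type S by <:].

Let norm (x : subspace_type S) : K := `|val x|.

Let normD x y : norm (x + y) <= norm x + norm y.
Proof. exact: ler_normD. Qed.

Let normZ (l : K) x : norm (l *: x) = `|l| * norm x.
Proof. exact: normrZ. Qed.

Let norm_eq0 x : norm x = 0 -> x = 0.
Proof. by move=> /normr0_eq0 x0; exact: val_inj. Qed.

HB.instance Definition _ :=
  Lmodule_isNormed.Build K (subspace_type S) normD normZ norm_eq0.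

End SubspaceType.

Section Operators.
Context {K : numFieldType}.
Implicit Types V W : normedModType K.

Definition bounded_op V W (f : V -> W) :=
  exists M : K, forall x, `|f x| <= M * `|x|.

Definition isomorphic V W :=
  exists (f : {linear V -> W}) (g : {linear W -> V}),
    [/\ cancel f g, cancel g f, continuous f & continuous g].

Definition complemented V (S : set V) :=
  exists P : {linear V -> V},
    [/\ bounded_op P, forall v, P (P v) = P v & range P = S].

Lemma kernel_submod_closed V W (f : {linear V -> W}) :
  submod_closed [pred x | f x == 0].
Proof.
split; first by rewrite inE linear0.
by move=> a x y; rewrite !inE => /eqP fx /eqP fy; rewrite linearP fx fy scaler0 addr0.
Qed.

Definition kernel_of V W (f : {linear V -> W}) : linear_subspace V :=
  LinearSubspace (kernel_submod_closed f).

End Operators.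

Section DualSpace.
Context {R : realType} {k : scalar_kind}.
Local Notation K := (scalars R k).
Variable V : normedModType K.

(* Bounded linear functionals; the dual norm is the supremum of |f x| over the
   closed unit ball. *)
Definition dual_pred : {pred V -> K} :=
  mem [set f : V -> K | scalar f /\ bounded_op f].

Lemma dual_pred_submod_closed : submod_closed dual_pred.
Proof.
split.
  rewrite inE; split; first by move=> a x y /=; rewrite mulr0 addr0.
  by exists 0 => x; rewrite mul0r normr0.
move=> a f g; rewrite !inE => -[lf [M fM]] [lg [N gN]]; split.
  move=> b x y; rewrite !fctE lf lg /GRing.scale/= !mulrDr.
  by rewrite addrACA mulrCA.
exists (`|a| * M + N) => x; rewrite !fctE (le_trans (ler_normD _ _))//.
by rewrite mulrDl lerD// normrZ -mulrA ler_wpM2l.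
Qed.

HB.instance Definition _ :=
  GRing.isSubmodClosed.Build K (V -> K) dual_pred dual_pred_submod_closed.

Record dual_space := DualSpace {
  dual_fun :> V -> K;
  dual_funP : dual_fun \in dual_pred
}.

HB.instance Definition _ := [isSub for dual_fun].
HB.instance Definition _ := [Choice of dual_space by <:].
HB.instance Definition _ := [SubChoice_isSubLmodule of dual_space by <:].

Lemma dual_scalar (f : dual_space) : scalar f.
Proof. by have := dual_funP f; rewrite inE => -[]. Qed.

Lemma dual_bounded_op (f : dual_space) : bounded_op f.
Proof. by have := dual_funP f; rewrite inE => -[]. Qed.

HB.instance Definition _ (f : dual_space) :=
  GRing.isLinear.Build K V K *%R (dual_fun f) (dual_scalar f).

Let unit_ball : set V := [set x | `|x| <= 1].

Let norm (f : dual_space) : K := supnorm unit_ball f.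

Let unit_ball0 : unit_ball !=set0.
Proof. by exists 0; rewrite /unit_ball/= normr0. Qed.

Let dual_bounded (f : dual_space) : bounded_on unit_ball f.
Proof.
have [M fM] := dual_bounded_op f.
exists `|M| => x x1; have /ger0_norm <- : 0 <= `|f x| by [].
rewrite (le_trans _ (_ : `|M| * `|x| <= _)) ?ler_piMr//.
by rewrite -[`|x|]normr_id -normrM ger0_le_norm ?fM// nnegrE// (le_trans _ (fM x)).
Qed.

Let normD f g : norm (f + g) <= norm f + norm g.
Proof. exact: supnormD. Qed.

Let normZ (l : K) f : norm (l *: f) = `|l| * norm f.
Proof. exact: supnormZ. Qed.

Let norm_eq0 f : norm f = 0 -> f = 0.
Proof.
move=> f0; apply/val_inj/funext => x /=.
have [->|x0] := eqVneq x 0; first by rewrite linear0.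
have x1 : unit_ball (`|x|^-1 *: x).
  by rewrite /unit_ball/= normrZ normfV normr_id mulVf// normr_eq0.
have /eqP := supnorm_eq0 (dual_bounded f) f0 x1.
by rewrite linearZ mulf_eq0 invr_eq0 normr_eq0 (negbTE x0) => /eqP.
Qed.

HB.instance Definition _ :=
  Lmodule_isNormed.Build K dual_space normD normZ norm_eq0.

Lemma ler_dual_norm (f : dual_space) x : `|f x| <= `|f| * `|x|.
Proof.
have [->|x0] := eqVneq x 0; first by rewrite linear0 !normr0 mulr0.
have x1 : unit_ball (`|x|^-1 *: x).
  by rewrite /unit_ball/= normrZ normfV normr_id mulVf// normr_eq0.
have := ler_supnorm (dual_bounded f) x1.
by rewrite linearZ normrM normfV normr_id mulrC ler_pdivrMr ?normr_gt0.
Qed.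

End DualSpace.

Section Bidual.
Context {R : realType} {k : scalar_kind}.
Local Notation K := (scalars R k).
Context {V : normedModType K}.

Definition bidual := dual_space (dual_space V).

HB.instance Definition _ := NormedModule.on bidual.

Lemma evaluation_dual (x : V) :
  (fun f : dual_space V => f x) \in dual_pred (V := dual_space V).
Proof.
rewrite inE; split; first by [].
by exists `|x| => f; rewrite mulrC ler_dual_norm.
Qed.

Definition bidual_embed (x : V) : bidual := DualSpace (evaluation_dual x).

End Bidual.
Arguments bidual {R k} V.

Section C0.
Variables (R : realType) (k : scalar_kind).
Local Notation K := (scalars R k).

Definition c0_pred : {pred nat -> K} :=
  mem [set u : nat -> K | u @ \oo --> (0 : K)].

Lemma c0_pred_submod_closed : submod_closed c0_pred.
Proof.
split; first by rewrite inE; exact: cvg_cst.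
move=> a u v; rewrite !inE => u0 v0.
rewrite -[0](addr0 0) -[X in X + _](mulr0 a); apply: cvgD => //.
exact: cvgMr.
Qed.

HB.instance Definition _ :=
  GRing.isSubmodClosed.Build K (nat -> K) c0_pred c0_pred_submod_closed.

Record c0 := C0 {
  c0_seq :> nat -> K;
  c0_seqP : c0_seq \in c0_pred
}.

HB.instance Definition _ := [isSub for c0_seq].
HB.instance Definition _ := [Choice of c0 by <:].
HB.instance Definition _ := [SubChoice_isSubLmodule of c0 by <:].

Let norm (u : c0) : K := supnorm setT u.

Let nat0 : [set: nat] !=set0. Proof. by exists 0. Qed.

Let c0_bounded (u : c0) : bounded_on setT u.
Proof.
have := c0_seqP u; rewrite inE => u0.
have /cvg_seq_bounded/pinfty_ex_gt0 : cvgn u by apply/cvg_ex; exists 0.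
by move=> [M _ uM]; exists M => i _; exact: uM.
Qed.

Let normD u v : norm (u + v) <= norm u + norm v.
Proof. exact: supnormD. Qed.

Let normZ (l : K) u : norm (l *: u) = `|l| * norm u.
Proof. exact: supnormZ. Qed.

Let norm_eq0 u : norm u = 0 -> u = 0.
Proof.
by move=> u0; apply/val_inj/funext => n /=; exact: (supnorm_eq0 _ u0).
Qed.

HB.instance Definition _ := Lmodule_isNormed.Build K c0 normD normZ norm_eq0.

End C0.

Section L1.
Context {R : realType} (k : scalar_kind) {d : measure_display}.
Context {T : measurableType d} (mu : {measure set T -> \bar R}).
Local Notation K := (scalars R k).

(* L1 is the quotient of the mu-integrable scalar functions (those whose real
   and imaginary parts are mu-integrable) by the functions vanishing mu-almost
   everywhere, normed by the integral of |f|; see [L1_classP] and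
   [L1_norm_class]. *)
Definition integrable_pred : {pred T -> K} :=
  mem [set f : T -> K |
    mu.-integrable setT (EFin \o (re \o f)) /\
    mu.-integrable setT (EFin \o (im \o f))].

Lemma integrable_pred_submod_closed : submod_closed integrable_pred.
Proof.
split.
  rewrite inE; split; rewrite (_ : _ \o _ = cst 0%E) ?integrable0//.
    by apply/funext => x /=; rewrite re0.
  by apply/funext => x /=; rewrite im0.
move=> a f g; rewrite !inE => -[rf imf] [rg img]; split.
- rewrite (_ : _ \o _ = ((fun x => (re a)%:E * (re (f x))%:E)
    \- (fun x => (im a)%:E * (im (f x))%:E) \+ (EFin \o (re \o g)))%E).
    by apply: integrableD => //; apply: integrableB => //; exact: integrableZl.
  by apply/funext => x /=; rewrite reD reM.
- rewrite (_ : _ \o _ = ((fun x => (re a)%:E * (im (f x))%:E)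
    \+ (fun x => (im a)%:E * (re (f x))%:E) \+ (EFin \o (im \o g)))%E).
    by apply: integrableD => //; apply: integrableD => //; exact: integrableZl.
  by apply/funext => x /=; rewrite imD imM.
Qed.

HB.instance Definition _ :=
  GRing.isSubmodClosed.Build K (T -> K) integrable_pred
    integrable_pred_submod_closed.

Record integrable_fun := IntegrableFun {
  integrable_val :> T -> K;
  integrable_valP : integrable_val \in integrable_pred
}.

HB.instance Definition _ := [isSub for integrable_val].
HB.instance Definition _ := [Choice of integrable_fun by <:].
HB.instance Definition _ := [SubChoice_isSubLmodule of integrable_fun by <:].

Definition ae_zero : {pred integrable_fun} :=
  mem [set f : integrable_fun | {ae mu, forall x, f x = 0}].

Lemma ae_zero_submod_closed : submod_closed ae_zero.
Proof.
split; first by rewrite inE; exact: aeW.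
move=> a f g; rewrite !inE; apply: filterS2 => x /= fx gx.
by rewrite !fctE fx gx scaler0 addr0.
Qed.

HB.instance Definition _ :=
  GRing.isSubmodClosed.Build K integrable_fun ae_zero ae_zero_submod_closed.

Definition L1 := Quotient.quot ae_zero.

HB.instance Definition _ := GRing.Zmodule.on L1.

Definition L1_class (f : integrable_fun) : L1 := \pi_L1 f.

Definition L1_repr (q : L1) : integrable_fun := repr q.

Lemma L1_reprK q : L1_class (L1_repr q) = q.
Proof. exact: reprK. Qed.

Lemma L1_classP f g :
  L1_class f = L1_class g <-> {ae mu, forall x, f x = g x}.
Proof.
have -> : L1_class f = L1_class g <-> f - g \in ae_zero.
  by rewrite Quotient.idealrBE; split=> [/eqP|/eqP].
rewrite inE; split; apply: filterS => x /=; rewrite !fctE.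
  by move/subr0_eq.
by move=> ->; rewrite subrr.
Qed.

Lemma L1_repr_class f : {ae mu, forall x, L1_repr (L1_class f) x = f x}.
Proof. by apply/L1_classP; rewrite L1_reprK. Qed.

Lemma L1_classD f g : L1_class (f + g) = L1_class f + L1_class g.
Proof. exact: (raddfD \pi_(Quotient.quot ae_zero)). Qed.

Lemma L1_class0 : L1_class 0 = 0.
Proof. exact: (raddf0 \pi_(Quotient.quot ae_zero)). Qed.

Definition L1_scale (a : K) (q : L1) : L1 := L1_class (a *: L1_repr q).

Lemma L1_scale_class a f : L1_scale a (L1_class f) = L1_class (a *: f).
Proof.
apply/L1_classP; have := L1_repr_class f; apply: filterS => x /= fx.
by rewrite !fctE fx.
Qed.

Let L1_scaleA a b q : L1_scale a (L1_scale b q) = L1_scale (a * b) q.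
Proof. by rewrite -[q]L1_reprK !L1_scale_class scalerA. Qed.

Let L1_scale1 : left_id 1 L1_scale.
Proof. by move=> q; rewrite -[q]L1_reprK L1_scale_class scale1r. Qed.

Let L1_scaleDr : right_distributive L1_scale +%R.
Proof.
move=> a p q; rewrite -[p]L1_reprK -[q]L1_reprK -L1_classD !L1_scale_class.
by rewrite scalerDr L1_classD.
Qed.

Let L1_scaleDl q : {morph L1_scale^~ q : a b / a + b}.
Proof.
move=> a b; rewrite -[q]L1_reprK !L1_scale_class.
by rewrite scalerDl L1_classD.
Qed.

HB.instance Definition _ := GRing.Zmodule_isLmodule.Build K L1
  L1_scaleA L1_scale1 L1_scaleDr L1_scaleDl.

Lemma L1_classZ a f : L1_class (a *: f) = a *: L1_class f.
Proof. by rewrite -L1_scale_class. Qed.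

Lemma integrable_re_norm (f : integrable_fun) :
  mu.-integrable setT (EFin \o (fun x => re `|f x|)).
Proof.
have := integrable_valP f; rewrite inE => -[rf imf].
have mre : measurable_fun setT (re \o f).
  by apply/measurable_EFinP; exact: measurable_int rf.
have mim : measurable_fun setT (im \o f).
  by apply/measurable_EFinP; exact: measurable_int imf.
apply: (le_integrable measurableT _ _
  (integrableD measurableT (integrable_norm rf) (integrable_norm imf))).
  apply/measurable_EFinP; rewrite (_ : (fun x => _) =
    Num.sqrt \o (fun x => (re \o f) x ^+ 2 + (im \o f) x ^+ 2)).
    apply: measurableT_comp.
      by apply: continuous_measurable_fun; exact: sqrt_continuous.
    by apply: measurable_funD; exact: measurable_funX.
  by apply/funext => x /=; rewrite re_norm.
move=> x _ /=; rewrite lee_fin re_norm ger0_norm ?sqrtr_ge0//.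
rewrite -sqrtr_sqr ler_wsqrtr// sqrrD !real_normK ?num_real//.
by rewrite addrAC lerDl mulrn_wge0// mulr_ge0.
Qed.

Definition L1_norm (q : L1) : K :=
  of_real (\int[mu]_x re `|L1_repr q x|).

Lemma L1_norm_class f : L1_norm (L1_class f) = of_real (\int[mu]_x re `|f x|).
Proof.
congr (of_real (fine _)); apply: ge0_ae_eq_integral => //.
- exact: measurable_int (integrable_re_norm _).
- exact: measurable_int (integrable_re_norm _).
- by move=> x _; rewrite lee_fin re_norm sqrtr_ge0.
- by move=> x _; rewrite lee_fin re_norm sqrtr_ge0.
- by have := L1_repr_class f; apply: filterS => x /= -> _.
Qed.

Let L1_normD p q : L1_norm (p + q) <= L1_norm p + L1_norm q.
Proof.
rewrite -[p]L1_reprK -[q]L1_reprK -L1_classD !L1_norm_class -of_realD.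
move: (L1_repr p) (L1_repr q) => f g; rewrite ler_of_real -RintegralD//;
  try exact: integrable_re_norm.
apply: le_Rintegral => //; first exact: integrable_re_norm.
  exact: (integrableD measurableT (integrable_re_norm f) (integrable_re_norm g)).
by move=> x _; rewrite -reD; exact/ler_re/ler_normD.
Qed.

Let L1_normZ (a : K) q : L1_norm (a *: q) = `|a| * L1_norm q.
Proof.
rewrite -[q]L1_reprK -L1_classZ !L1_norm_class -[`|a|]of_real_re_norm.
rewrite -of_realM -RintegralZl//; last exact: integrable_re_norm.
congr of_real; apply: eq_Rintegral => x _.
rewrite -[LHS]/(re `|a * L1_repr q x|) normrM.
rewrite -[`|a|]of_real_re_norm -[`|L1_repr q x|]of_real_re_norm.
by rewrite -of_realM !of_realK.
Qed.

Let L1_norm_eq0 q : L1_norm q = 0 -> q = 0.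
Proof.
rewrite -[q]L1_reprK L1_norm_class -L1_class0; move: (L1_repr q) => f f0.
apply/L1_classP.
have {f0} /eqP : \int[mu]_x re `|f x| = 0 by rewrite -[LHS](@of_realK R k) f0 re0.
have If := integrable_re_norm f.
rewrite /Rintegral fine_eq0 ?integrable_fin_num// => /eqP f0.
have : (\int[mu]_x `|(re `|f x|)%:E| = 0)%E.
  rewrite -[RHS]f0; apply: eq_integral => x _.
  by rewrite gee0_abs// lee_fin re_norm sqrtr_ge0.
move/(ae_eq_integral_abs mu measurableT (measurable_int mu If)).
apply: filterS => x /(_ I) [fx0] /=.
by apply/eqP; rewrite -normr_eq0 -of_real_re_norm fx0 of_real0.
Qed.

HB.instance Definition _ :=
  Lmodule_isNormed.Build K L1 L1_normD L1_normZ L1_norm_eq0.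

End L1.

(* Main.v *)
(* Suppose that ker Q is complemented in its bidual.  Composing the projection
   with weak-star ultralimits yields generalized limits of bounded sequences in
   ker Q, and with them (Lindenstrauss' lifting argument) every bounded dyadic
   martingale in E which lifts, term by term, to a bounded family in L1(mu) lifts
   to a bounded martingale y in L1(mu).

   On the other hand, extend the coordinate functionals of the copy of c0 to E and
   pull them back to L1(mu).  As mu is finite they are bounded for the L2 norm, so
   the parallelogram law gives successive convex blocks u_n, v_n of them such that
   h_n = u_n - v_n tends to 0 in the dual of L2.  Let w_n be the sum of the unit
   vectors of c0 over the block u_n, so that h_n is 1 at w_n, and lift the bounded
   martingale whose increments are +- w_n.  Its n-th increment, averaged with
   signs, is some r_n in L1(mu) with Q r_n = w_n, and |r_n| is at most the average
   of |y_s| over the words s of length n + 1.  These averages increase with n and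
   have bounded integrals, hence |r_n| <= G for an integrable G; truncating at a
   level of G then shows that h_n(r_n) gets small, whereas h_n(r_n) = 1. *)
Require Import Defs.
From HB Require Import structures.
From mathcomp Require Import all_boot all_order all_algebra complex.
From mathcomp Require Import all_classical all_reals all_analysis.
From mathcomp Require Import measurable_realfun.
From mathcomp Require Import ring lra.

Set Implicit Arguments.
Unset Strict Implicit.
Unset Printing Implicit Defensive.

Import Order.TTheory GRing.Theory Num.Theory.
Import numFieldNormedType.Exports.

Local Open Scope classical_set_scope.
Local Open Scope ring_scope.

(** * Real and complex scalars, and the real-valued norm *)

Section RealScalars.
Context {R : realType} {k : scalar_kind}.
Local Notation K := (scalars R k).

Lemma im_of_real (t : R) : im (of_real t : K) = 0.
Proof. by rewrite /im /of_real; case: k. Qed.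

Lemma of_real1 : of_real 1 = 1 :> K.
Proof. by rewrite /of_real; case: k. Qed.

Lemma of_realN (t : R) : of_real (- t) = - of_real t :> K.
Proof. by apply/eqP; rewrite -addr_eq0 -of_realD addNr of_real0. Qed.

Lemma of_realV2 : of_real 2^-1 = 2^-1 :> K.
Proof.
rewrite -[RHS]mul1r; apply: (canRL (mulfK _)); first by rewrite pnatr_eq0.
rewrite mulr_natr mulr2n -of_realD -mulr2n -[X in of_real X]mulr_natr.
by rewrite mulVf ?pnatr_eq0// of_real1.
Qed.

Lemma ltr_of_real (x y : R) : (of_real x < of_real y :> K) = (x < y).
Proof.
rewrite !lt_neqAle ler_of_real; congr (~~ _ && _).
by apply/eqP/eqP => [/(congr1 re)|->//]; rewrite !of_realK.
Qed.

Lemma norm_of_real (t : R) : `|of_real t : K| = of_real `|t|.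
Proof.
have [t0|t0] := leP 0 t.
  by rewrite !ger0_norm// -of_real0 ler_of_real.
by rewrite !ltr0_norm ?of_realN// -of_real0 ltr_of_real.
Qed.

Lemma le_re_norm (a : K) : re a <= re `|a|.
Proof.
by rewrite re_norm (le_trans (ler_norm _))// -sqrtr_sqr ler_wsqrtr// lerDl sqr_ge0.
Qed.

End RealScalars.

Section RealNorm.
Context {R : realType} {k : scalar_kind}.
Local Notation K := (scalars R k).

(** The norm of a module over K is K-valued; a real version lets one order argument serve both kinds
    of scalars. *)
Definition rnorm {V : normedModType K} (x : V) : R := re `|x|.

Context {V : normedModType K}.
Implicit Types (x y : V) (t : R).

Lemma normE x : `|x| = of_real (rnorm x).
Proof. by rewrite ge0_reK. Qed.

Lemma rnorm_ge0 x : 0 <= rnorm x.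
Proof. by rewrite -(@ler_of_real R k) of_real0 -normE. Qed.

Lemma rnorm0 : rnorm (0 : V) = 0.
Proof. by rewrite /rnorm normr0 re0. Qed.

Lemma rnormD x y : rnorm (x + y) <= rnorm x + rnorm y.
Proof. by rewrite -(@ler_of_real R k) of_realD -!normE ler_normD. Qed.

Lemma rnormZK (a : K) x : rnorm (a *: x) = re `|a| * rnorm x.
Proof.
by rewrite /rnorm normrZ -{1}[`|a|]of_real_re_norm normE -of_realM !of_realK.
Qed.

Lemma rnormZ t x : rnorm (of_real t *: x) = `|t| * rnorm x.
Proof. by rewrite rnormZK norm_of_real of_realK. Qed.

Lemma rnormN x : rnorm (- x) = rnorm x.
Proof. by rewrite /rnorm normrN. Qed.

Lemma rnormB x y : rnorm (x - y) <= rnorm x + rnorm y.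
Proof. by rewrite (le_trans (rnormD _ _))// rnormN. Qed.

Lemma rnormC x y : rnorm (x - y) = rnorm (y - x).
Proof. by rewrite -rnormN opprB. Qed.

Lemma rnorm_eq0 x : rnorm x = 0 -> x = 0.
Proof. by move=> x0; apply/normr0_eq0; rewrite normE x0 of_real0. Qed.

Lemma rnorm_half x : rnorm (2^-1 *: x) = 2^-1 * rnorm x.
Proof. by rewrite -of_realV2 rnormZ ger0_norm// invr_ge0. Qed.

Lemma rnorm_small x : (forall e, 0 < e -> rnorm x <= e) -> x = 0.
Proof.
move=> x0; apply: rnorm_eq0; apply/eqP; rewrite eq_le rnorm_ge0 andbT.
by apply/ler_addgt0Pl => e /x0; rewrite addr0.
Qed.

(** Real values and homogeneity for real scalars only, on a module over K: real parts of K-linear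
    functionals have this form. *)
Definition real_linear {U : lmodType K} (f : U -> R) :=
  forall t (u v : U), f (of_real t *: u + v) = t * f u + f v.

Section Theory.
Context {U : lmodType K} (f : U -> R) (fl : real_linear f).

Lemma real_linear0 : f 0 = 0.
Proof.
have := fl 1 0 0; rewrite of_real1 scale1r addr0 mul1r.
by move=> /esym; rewrite -{3}[f 0]addr0 => /addrI.
Qed.

Lemma real_linearD u v : f (u + v) = f u + f v.
Proof. by have := fl 1 u v; rewrite of_real1 scale1r mul1r. Qed.

Lemma real_linearZ t u : f (of_real t *: u) = t * f u.
Proof. by have := fl t u 0; rewrite real_linear0 !addr0. Qed.

Lemma real_linearN u : f (- u) = - f u.
Proof. by have := real_linearZ (-1) u; rewrite of_realN of_real1 scaleN1r mulN1r. Qed.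

Lemma real_linearB u v : f (u - v) = f u - f v.
Proof. by rewrite real_linearD real_linearN. Qed.

End Theory.

End RealNorm.

Section BoundedOperators.
Context {R : realType} {k : scalar_kind}.
Local Notation K := (scalars R k).
Context {V W : normedModType K}.

Lemma bounded_op_rnorm (f : V -> W) : bounded_op f ->
  exists2 M : R, 0 <= M & forall x, rnorm (f x) <= M * rnorm x.
Proof.
move=> [M fM]; exists `|re M| => // x.
have := fM x; rewrite [`|x|]normE => /ler_re /le_trans; apply.
by rewrite reM im_of_real mulr0 subr0 of_realK ler_wpM2r ?rnorm_ge0// ler_norm.
Qed.

End BoundedOperators.

(** * The Hahn-Banach theorem for real-linear functionals *)

Section HahnBanach.
Context {R : realType} {k : scalar_kind}.
Local Notation K := (scalars R k).
Context {V : normedModType K}.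
Implicit Types (C : R) (G : set (V * R)).

(** The graph of a real-linear functional on a real subspace. Single-valuedness follows from
    domination, applied to the difference of two pairs over the same vector. *)
Definition dominated_graph C (G : set (V * R)) :=
  [/\ G (0, 0),
      forall t x r y s, G (x, r) -> G (y, s) ->
        G (of_real t *: x + y, t * r + s) &
      forall x r, G (x, r) -> r <= C * rnorm x].

Lemma dominated_graph_fun C G x r s : dominated_graph C G -> G (x, r) -> G (x, s) ->
  r = s.
Proof.
move=> [G0 GD Gle]; wlog: r s / r <= s => [h|rs] Gr Gs.
  by have [/h|/ltW/h] := leP r s; [exact|move=> <-].
have := Gle _ _ (GD (-1) _ _ _ _ Gr Gs).
rewrite of_realN of_real1 scaleN1r addNr rnorm0 mulr0 mulN1r => sr.
by apply/eqP; rewrite eq_le rs/=; lra.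
Qed.

Lemma dominated_graph_extend C G v : 0 <= C -> dominated_graph C G ->
  exists a, dominated_graph C
    [set p | exists x r t, [/\ G (x, r), p.1 = x + of_real t *: v & p.2 = r + t * a]].
Proof.
move=> C0 [G0 GD Gle].
have GZ t x r : G (x, r) -> G (of_real t *: x, t * r).
  by move=> Gx; have := GD t _ _ _ _ Gx G0; rewrite !addr0.
(* The value at v has to lie above every [r - C * rnorm (x - v)] and below every
   [C * rnorm (y + v) - s]. The triangle inequality separates the two families, so the supremum of
   the first is admissible. *)
pose B : set R := [set z | exists x r, G (x, r) /\ z = r - C * rnorm (x - v)].
have ubB y s : G (y, s) -> ubound B (C * rnorm (y + v) - s).
  move=> Gy _ [x [r [Gx ->]]].
  have := Gle _ _ (GD 1 _ _ _ _ Gx Gy); rewrite of_real1 scale1r mul1r.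
  have -> : x + y = (x - v) + (y + v) by rewrite addrACA addNr addr0.
  have := ler_wpM2l C0 (rnormD (x - v) (y + v)); rewrite mulrDr; lra.
have B0 : B !=set0 by exists (0 - C * rnorm (0 - v)), 0, 0.
have supB : has_sup B by split=> //; exists (C * rnorm (0 + v) - 0); exact: ubB.
exists (sup B); split => /=.
- by exists 0, 0, 0; rewrite of_real0 scale0r mul0r !addr0.
- move=> t x1 r1 y1 s1 [x [r [a [Gx -> ->]]]] [y [s [b [Gy -> ->]]]].
  exists (of_real t *: x + y), (t * r + s), (t * a + b); split; first exact: GD.
    by rewrite of_realD of_realM scalerDr scalerDl scalerA addrACA.
  by rewrite mulrDr mulrDl mulrA addrACA.
- move=> _ _ [x [r [t [Gx -> ->]]]].
  (* For t > 0, scale by [t^-1] and use that [sup B] is below the upper bounds of B; for t < 0,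
     scale by [(- t)^-1] and use that [sup B] is above the elements of B. *)
  have [t0|t0|->] := ltgtP t 0; last first.
  + by rewrite of_real0 scale0r mul0r !addr0; exact: Gle.
  + have tne : t != 0 by rewrite gt_eqF.
    have := @ge_sup _ B _ B0 (ubB _ _ (GZ t^-1 _ _ Gx)).
    have cancelt z : t * (t^-1 * z) = z by rewrite mulrA mulfV// mul1r.
    have -> : of_real t^-1 *: x + v = of_real t^-1 *: (x + of_real t *: v).
      by rewrite scalerDr scalerA -of_realM mulVf// of_real1 scale1r.
    rewrite -(ler_pM2l t0) mulrBr cancelt rnormZ gtr0_norm ?invr_gt0//.
    by rewrite mulrCA cancelt; lra.
  + have tne : t != 0 by rewrite lt_eqF.
    have nt0 : 0 < - t by rewrite oppr_gt0.
    have Bx : B ((- t)^-1 * r - C * rnorm (of_real (- t)^-1 *: x - v)).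
      by exists (of_real (- t)^-1 *: x), ((- t)^-1 * r); split => //; exact: GZ.
    have := ub_le_sup supB.2 Bx.
    have -> : of_real (- t)^-1 *: x - v = of_real (- t)^-1 *: (x + of_real t *: v).
      have tN1 : (- t)^-1 * t = - 1 by rewrite invrN mulNr mulVf.
      by rewrite scalerDr scalerA -of_realM tN1 of_realN of_real1 scaleN1r.
    have cancelt z : - t * ((- t)^-1 * z) = z.
      by rewrite mulrA mulfV ?oppr_eq0// mul1r.
    rewrite rnormZ gtr0_norm ?invr_gt0// -(ler_pM2l nt0) mulrBr cancelt.
    by rewrite mulrCA cancelt; lra.
Qed.

(* Only real-linear functionals are extended, which treats both kinds of
   scalars at once. *)
Theorem Hahn_Banach C G : 0 <= C -> dominated_graph C G ->
  exists f : V -> R, [/\ real_linear f, forall x, f x <= C * rnorm x &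
    forall x r, G (x, r) -> f x = r].
Proof.
move=> C0 domG.
(* The alternative that H lies in G admits the empty chain, whose union does not contain
   [(0, 0)]. *)
pose P (H : set (V * R)) := H `<=` G \/ G `<=` H /\ dominated_graph C H.
have [|H [PH maxH]] := @Zorn_bigcup _ P.
  move=> F FP totF.
  have [[H0 FH0 GH0]|FG] :=
    pselect (exists2 H, F H & G `<=` H /\ dominated_graph C H); last first.
    left => p [H FH Hp]; have [|GH] := FP _ FH; first exact.
    by exfalso; apply: FG; exists H.
  right; split; first by move=> p Gp; exists H0 => //; exact: GH0.1.
  have FD H : F H -> exists2 H', F H' & H `<=` H' /\ dominated_graph C H'.
    move=> FH; have [HG|GH] := FP _ FH; last by exists H => //; split=> //; exact: GH.2.
    exists H0 => //; split; last exact: GH0.2.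
    exact: subset_trans HG GH0.1.
  split.
  - by exists H0 => //; have [] := GH0.2.
  - move=> t x r y s [H1 /FD[H1' F1 [s1 [_ D1 _]]] /s1 Gx].
    move=> [H2 /FD[H2' F2 [s2 [_ D2 _]]] /s2 Gy].
    have [s12|s21] := totF _ _ F1 F2.
      by exists H2' => //; apply: D2 => //; exact: s12.
    by exists H1' => //; apply: D1 => //; exact: s21.
  - by move=> x r [H1 /FD[H1' F1 [s1 [_ _ D1]]] /s1]; exact: D1.
have {PH} [GH domH] : G `<=` H /\ dominated_graph C H.
  have [HG|//] := PH.
  have GH : G `<=` H.
    by apply: contrapT => nGH; apply: (maxH G); [split|left].
  have -> : H = G by apply/seteqP.
  by split.
have tot v : exists r, H (v, r).
  have [a domH'] := dominated_graph_extend v C0 domH.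
  set H' := (X in dominated_graph C X) in domH'.
  have HH' : H `<=` H'.
    by move=> [x r] Hx; exists x, r, 0; rewrite of_real0 scale0r mul0r !addr0.
  have H'v : H' (v, a).
    exists 0, 0, 1; rewrite of_real1 scale1r mul1r !add0r; split => //.
    by have [] := domH.
  have [H'H|nH'H] := pselect (H' `<=` H); first by exists a; exact: H'H.
  exfalso; apply: (maxH H'); first by split.
  by right; split => //; exact: subset_trans HH'.
have [f Hf] := choice tot.
have [_ HD Hle] := domH.
exists f; split.
- by move=> t x y; apply: (dominated_graph_fun domH (Hf _)); exact: HD.
- by move=> x; exact: Hle.
- by move=> x r /GH; exact: (dominated_graph_fun domH).
Qed.

(** Extends the functional with value [t * rnorm v] at t v from the real line through v. *)
Lemma norming_functional (v : V) : exists f : V -> R,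
  [/\ real_linear f, forall x, f x <= rnorm x & f v = rnorm v].
Proof.
have [|f [fl fle fG]] :=
    @Hahn_Banach 1 [set p | exists t, p = (of_real t *: v, t * rnorm v)] ler01.
- split.
  + by exists 0; rewrite of_real0 scale0r mul0r.
  + move=> t _ _ _ _ [a [-> ->]] [b [-> ->]]; exists (t * a + b).
    by rewrite scalerA -of_realM -scalerDl -of_realD mulrA -mulrDl.
  + move=> _ _ [t [-> ->]]; rewrite mul1r rnormZ ler_wpM2r ?rnorm_ge0//.
    exact: ler_norm.
- exists f; split => // [x|]; first by rewrite -[leRHS]mul1r.
  by apply: fG; exists 1; rewrite of_real1 scale1r mul1r.
Qed.

End HahnBanach.

(** * Generalized limits of bounded scalar sequences *)

Section UltraLimit.
Context {R : realType}.

(** By compactness of [-M, M] the image ultrafilter has a cluster point, and an ultrafilter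
    converges to each of its cluster points. *)
Lemma bounded_ultra_cvg (U : set_system nat) (M : R) (u : nat -> R) :
  UltraFilter U -> (forall n, `|u n| <= M) -> cvg (u @ U).
Proof.
move=> UU uM; have UP : ProperFilter U by exact: ultra_proper.
have [|p [_ up]] := @segment_compact R (- M) M (u @ U) _.
  by apply: (@filterE _ U) => n /=; rewrite in_itv/= -ler_norml.
apply/cvg_ex; exists p => A Ap.
have [//|UnA] := in_ultra_setVsetC (u @^-1` A) UU.
by have [x [nAx Ax]] := up (~` A) A UnA Ap.
Qed.

(** LIM is the limit along an ultrafilter finer than the Frechet filter, so it ignores finitely many
    terms. *)
Lemma bounded_real_limit : exists LIM : (nat -> R) -> R,
  [/\ forall a M N u v, (forall n, `|u n| <= M) -> (forall n, `|v n| <= N) ->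
        LIM (fun n => a * u n + v n) = a * LIM u + LIM v,
      forall M u, (forall n, `|u n| <= M) -> `|LIM u| <= M &
      forall c N u, (forall n, (N <= n)%N -> u n = c) -> LIM u = c].
Proof.
have [U [UU ooU]] := ultraFilterLemma eventually_filter.
have UP : ProperFilter U by exact: ultra_proper.
exists (fun u => lim (u @ U)); split.
- move=> a M N u v uM vN; apply: cvg_lim => //; apply: cvgD.
    by apply: cvgMr; exact: bounded_ultra_cvg uM.
  exact: bounded_ultra_cvg vN.
- move=> M u uM; have cu := bounded_ultra_cvg UU uM.
  rewrite ler_norml; apply/andP; split.
    apply: limr_ge; first exact: cu.
    by apply: nearW => n; have := uM n; rewrite ler_norml => /andP[].
  apply: limr_le; first exact: cu.
  by apply: nearW => n; have := uM n; rewrite ler_norml => /andP[].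
- move=> c N u uc; apply: cvg_lim => //.
  move=> A Ac; apply: ooU; exists N => // n /= /uc ->.
  exact: nbhs_singleton.
Qed.

End UltraLimit.

Section ScalarLimit.
Context {R : realType} {k : scalar_kind}.
Local Notation K := (scalars R k).

Definition cart (x y : R) : K :=
  match k return scalars R k with
  | RealScalars => x
  | ComplexScalars => Complex x y
  end.

Lemma cart_re_im (a : K) : cart (re a) (im a) = a.
Proof. by rewrite /cart /re /im; case: k a => //= -[]. Qed.

Lemma cartD x y x' y' : cart (x + x') (y + y') = cart x y + cart x' y'.
Proof. by rewrite /cart; case: k. Qed.

Lemma cartM (a : K) x y :
  cart (re a * x - im a * y) (re a * y + im a * x) = a * cart x y.
Proof. by rewrite /cart /re /im; case: k a => //= [a|[c e]]; rewrite ?mul0r ?subr0. Qed.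

Lemma re_cart x y : re (cart x y) = x.
Proof. by rewrite /re /cart; case: k. Qed.

Lemma cart_norm_le x y : re `|cart x y| <= `|x| + `|y|.
Proof.
rewrite re_norm re_cart -[leRHS]ger0_norm ?addr_ge0// -sqrtr_sqr ler_wsqrtr//.
have : im (cart x y) ^+ 2 <= y ^+ 2.
  by rewrite /im /cart; case: k => //=; rewrite expr0n sqr_ge0.
rewrite sqrrD !real_normK ?num_real//.
have : 0 <= `|x| * `|y| by rewrite mulr_ge0.
lra.
Qed.

Lemma norm_re_le (a : K) : `|re a| <= re `|a|.
Proof. by rewrite re_norm -sqrtr_sqr ler_wsqrtr// lerDl sqr_ge0. Qed.

Lemma norm_im_le (a : K) : `|im a| <= re `|a|.
Proof. by rewrite re_norm -sqrtr_sqr ler_wsqrtr// lerDr sqr_ge0. Qed.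

(** The limits of the real and imaginary parts are taken separately; adding their bounds gives the
    factor 2. *)
Lemma bounded_scalar_limit : exists LIM : (nat -> K) -> K,
  [/\ forall a M N u v, (forall n, re `|u n| <= M) -> (forall n, re `|v n| <= N) ->
        LIM (fun n => a * u n + v n) = a * LIM u + LIM v,
      forall M u, (forall n, re `|u n| <= M) -> re `|LIM u| <= 2 * M &
      forall c N u, (forall n, (N <= n)%N -> u n = c) -> LIM u = c].
Proof.
have [LIM [LIMD LIMle LIMcst]] := @bounded_real_limit R.
have re_bnd M (u : nat -> K) (uM : forall n, re `|u n| <= M) n : `|re (u n)| <= M.
  exact: le_trans (norm_re_le _) (uM n).
have im_bnd M (u : nat -> K) (uM : forall n, re `|u n| <= M) n : `|im (u n)| <= M.
  exact: le_trans (norm_im_le _) (uM n).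
exists (fun u => cart (LIM (fun n => re (u n))) (LIM (fun n => im (u n)))); split.
- move=> a M N u v uM vN; rewrite -cartM -cartD.
  have comb (x y : R) (f g h : nat -> R) M' N' P' : (forall n, `|f n| <= M') ->
      (forall n, `|g n| <= N') -> (forall n, `|h n| <= P') ->
      LIM (fun n => x * f n + (y * g n + h n)) = x * LIM f + y * LIM g + LIM h.
    move=> fM gN hP; rewrite (LIMD _ M' (`|y| * N' + P'))// => [|n].
      by rewrite (LIMD _ N' P')// addrA.
    by rewrite (le_trans (ler_normD _ _))// lerD// normrM ler_wpM2l.
  congr cart.
    rewrite -mulNr -(comb _ _ _ _ _ _ _ _ (re_bnd _ _ uM) (im_bnd _ _ uM) (re_bnd _ _ vN)).
    by congr LIM; apply/funext => n; rewrite reD reM mulNr addrA.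
  rewrite -(comb _ _ _ _ _ _ _ _ (im_bnd _ _ uM) (re_bnd _ _ uM) (im_bnd _ _ vN)).
  by congr LIM; apply/funext => n; rewrite imD imM addrA.
- move=> M u uM; rewrite (le_trans (cart_norm_le _ _))// mulr_natl mulr2n lerD//.
    by apply: LIMle; exact: re_bnd.
  by apply: LIMle; exact: im_bnd.
- move=> c N u uc; rewrite -[RHS]cart_re_im; congr cart.
    by apply: (LIMcst _ N) => n /uc ->.
  by apply: (LIMcst _ N) => n /uc ->.
Qed.

End ScalarLimit.

(** * Duality, and generalized limits in a space complemented in its bidual *)

Section DualNorm.
Context {R : realType} {k : scalar_kind}.
Local Notation K := (scalars R k).
Context {V : normedModType K}.

Lemma dual_norm_le (f : dual_space V) (M : R) : 0 <= M ->
  (forall x, rnorm x <= 1 -> re `|f x| <= M) -> rnorm f <= M.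
Proof.
move=> M0 fM; rewrite -(@ler_of_real R k) -normE; apply: supnorm_le.
  by exists 0; rewrite /= normr0.
move=> x /= x1; rewrite -[leLHS]of_real_re_norm ler_of_real; apply: fM.
by rewrite -(@ler_of_real R k) -normE of_real1.
Qed.

Lemma ler_dual_rnorm (f : dual_space V) x : re `|f x| <= rnorm f * rnorm x.
Proof.
by rewrite -(@ler_of_real R k) of_realM of_real_re_norm -!normE ler_dual_norm.
Qed.

End DualNorm.

Section BidualLimit.
Context {R : realType} {k : scalar_kind}.
Local Notation K := (scalars R k).
Context {V : normedModType K}.

(* For real scalars [cart 0 1] is 0 and [cart] drops its second argument, so
   that both cases of the complexification are covered by the same formula. *)
Lemma complexified_functional (f : V -> R) : real_linear f ->
  (forall x, f x <= rnorm x) ->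
  exists2 g : dual_space V, forall x, re (g x) = f x & rnorm g <= 2.
Proof.
move=> fl fle; pose i : K := cart 0 1.
(* The classical complexification g x = f x - i f (i x). *)
pose g x := cart (f x) (- f (i *: x)) : K.
have i_re a : i * a = of_real (re a) * i - of_real (im a).
  rewrite /i /cart /re /im /of_real; case: k a => [a|[a b]].
    by rewrite mul0r mulr0 subr0.
  by apply/eqP; rewrite eq_complex /=; apply/andP; split; apply/eqP; ring.
have a_re a : a = of_real (re a) + of_real (im a) * i :> K.
  rewrite /i /cart /re /im /of_real; case: k a => [a|[a b]].
    by rewrite mulr0 addr0.
  by apply/eqP; rewrite eq_complex /=; apply/andP; split; apply/eqP; ring.
have lg : scalar g.
  move=> a x y; rewrite /g scalerDr !(real_linearD fl) opprD cartD -cartM.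
  congr (cart _ _ + _).
    rewrite {1}(a_re a) scalerDl -scalerA !(real_linearD fl) !(real_linearZ fl).
    by rewrite mulrN opprK.
  rewrite scalerA i_re scalerBl -scalerA (real_linearB fl) !(real_linearZ fl).
  by rewrite opprB mulrN addrC.
have fabs x : `|f x| <= rnorm x.
  by rewrite ler_norml fle andbT lerNl -(real_linearN fl) -[rnorm x]rnormN.
have i1 : re `|i| <= 1.
  by rewrite (le_trans (cart_norm_le _ _))// normr0 normr1 add0r.
have gle x : re `|g x| <= 2 * rnorm x.
  rewrite (le_trans (cart_norm_le _ _))// mulr_natl mulr2n lerD// normrN.
  rewrite (le_trans (fabs _))// rnormZK -[leRHS]mul1r.
  by rewrite ler_wpM2r ?rnorm_ge0.
have bg : g \in dual_pred (V := V).
  rewrite inE; split => //; exists (of_real 2) => x.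
  by rewrite [`|x|]normE -of_realM -[leLHS]of_real_re_norm ler_of_real.
exists (DualSpace bg) => [x|]; first exact: re_cart.
by apply: dual_norm_le => // x x1; rewrite (le_trans (gle x))// ler_piMr.
Qed.

Lemma bidual_embedD (t : R) (x y : V) :
  bidual_embed (of_real t *: x + y) = of_real t *: bidual_embed x + bidual_embed y.
Proof. by apply/val_inj/funext => f /=; rewrite linearP. Qed.

(** Test x against its norming functional, complexified to an element of the dual of norm at most 2;
    hence the factor 2. *)
Lemma rnorm_bidual_embed (x : V) : rnorm x <= 2 * rnorm (bidual_embed x).
Proof.
have [f [fl fle fx]] := norming_functional x.
have [g gf g2] := complexified_functional fl fle.
rewrite -fx -gf (le_trans (le_re_norm _))//.
have := @ler_dual_norm R k _ (bidual_embed x) g; rewrite /= => /ler_re.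
move/le_trans; apply; rewrite !normE -of_realM of_realK mulrC.
by rewrite ler_wpM2r ?rnorm_ge0.
Qed.

Lemma bidual_embed_inj : injective (@bidual_embed R k V).
Proof.
move=> x y xy; apply/eqP; rewrite -subr_eq0; apply/eqP/rnorm_eq0/eqP.
rewrite eq_le rnorm_ge0 andbT (le_trans (rnorm_bidual_embed _))//.
have -> : x - y = of_real (-1) *: y + x.
  by rewrite of_realN of_real1 scaleN1r addrC.
by rewrite bidual_embedD xy of_realN of_real1 scaleN1r addNr rnorm0 mulr0.
Qed.

(* A projection of the bidual turns weak-star ultralimits of bounded sequences
   into generalized limits with values in V. *)
Lemma complemented_vector_limit : complemented (range (@bidual_embed R k V)) ->
  exists2 C : R, 0 <= C & exists L : (nat -> V) -> V,
  [/\ forall t M N x y, (forall n, rnorm (x n) <= M) -> (forall n, rnorm (y n) <= N) ->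
        L (fun n => of_real t *: x n + y n) = of_real t *: L x + L y,
      forall M x, (forall n, rnorm (x n) <= M) -> rnorm (L x) <= C * M &
      forall c N x M, (forall n, rnorm (x n) <= M) ->
        (forall n, (N <= n)%N -> x n = c) -> L x = c].
Proof.
move=> [P [/bounded_op_rnorm[B B0 PB] PP Prange]].
have [LIM [LIMD LIMle LIMcst]] := @bounded_scalar_limit R k.
have fx_bound (x : nat -> V) M (f : dual_space V) : (forall n, rnorm (x n) <= M) ->
    forall n, re `|f (x n)| <= rnorm f * M.
  by move=> xM n; rewrite (le_trans (ler_dual_rnorm _ _))// ler_wpM2l ?rnorm_ge0.
(* The scalar limit, taken at each functional, is the weak-star limit in the bidual of the embedded
   sequence. *)
have wlim (x : nat -> V) M : (forall n, rnorm (x n) <= M) -> exists phi : bidual V,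
    (forall f, phi f = LIM (fun n => f (x n))) /\ rnorm phi <= 2 * M.
  move=> xM; have M0 : 0 <= M by rewrite (le_trans _ (xM 0%N))// rnorm_ge0.
  have phile (f : dual_space V) : re `|LIM (fun n => f (x n))| <= 2 * (rnorm f * M).
    by apply: LIMle; exact: fx_bound.
  have bphi : (fun f : dual_space V => LIM (fun n => f (x n))) \in
      dual_pred (V := dual_space V).
    rewrite inE; split.
      move=> a f g /=.
      by rewrite -(LIMD a _ _ _ _ (fx_bound _ _ f xM) (fx_bound _ _ g xM)).
    exists (of_real (2 * M)) => f; rewrite -[leLHS]of_real_re_norm [`|f|]normE -of_realM.
    by rewrite ler_of_real (le_trans (phile f))// mulrA mulrAC.
  exists (DualSpace bphi); split => //.
  apply: (@dual_norm_le R k (dual_space V) (DualSpace bphi)); first by rewrite mulr_ge0.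
  by move=> f f1; rewrite (le_trans (phile f))// ler_wpM2l// ler_piMl.
(* For bounded x, v is the vector whose canonical image is [P phi]. Since phi is determined by x
   alone, one v serves every bound M; an unbounded sequence gets the value 0. *)
have ex_L (x : nat -> V) : exists v : V, forall M, (forall n, rnorm (x n) <= M) ->
    exists phi : bidual V, [/\ forall f, phi f = LIM (fun n => f (x n)),
      rnorm phi <= 2 * M & P phi = bidual_embed v].
  have [[M xM]|nobound] := pselect (exists M, forall n, rnorm (x n) <= M); last first.
    by exists 0 => M xM; exfalso; apply: nobound; exists M.
  have [phi [phiE _]] := wlim x M xM.
  have : range P (P phi) by exists phi.
  rewrite Prange => -[v _ Pphi]; exists v => N xN.
  have [psi [psiE psiN]] := wlim x N xN; exists psi; split => //.
  by rewrite Pphi; congr (P _); apply/val_inj/funext => f /=; rewrite psiE phiE.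
have [L LP] := choice ex_L.
(* One factor 2 comes from the scalar limit, the other from [rnorm_bidual_embed]. *)
exists (4 * B); first by rewrite mulr_ge0.
exists L; split.
- move=> t M N x y xM yN; apply: bidual_embed_inj; rewrite bidual_embedD.
  have [|p [pE _ <-]] := LP (fun n => of_real t *: x n + y n) (`|t| * M + N).
    by move=> n; rewrite (le_trans (rnormD _ _))// lerD// rnormZ ler_wpM2l.
  have [px [pxE _ <-]] := LP x M xM; have [py [pyE _ <-]] := LP y N yN.
  rewrite -linearP; congr (P _); apply/val_inj/funext => f /=.
  rewrite pE /= !fctE pxE pyE.
  rewrite -[RHS](LIMD _ _ _ _ _ (fx_bound _ _ f xM) (fx_bound _ _ f yN)).
  by congr LIM; apply/funext => n; rewrite linearP.
- move=> M x xM; have [p [_ p2 Pp]] := LP x M xM.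
  rewrite (le_trans (rnorm_bidual_embed _))// -Pp.
  by have := PB p; have := ler_wpM2l B0 p2; lra.
- move=> c N x M xM xc; have [p [pE _ Pp]] := LP x M xM.
  apply: bidual_embed_inj; rewrite -Pp.
  (* The weak-star limit of an eventually constant sequence is the embedded constant, which P
     fixes. *)
  have -> : p = bidual_embed c.
    by apply/val_inj/funext => f /=; rewrite pE; apply: (LIMcst _ N) => n /xc ->.
  have : range (@bidual_embed R k V) (bidual_embed c) by exists c.
  by rewrite -Prange => -[q _ <-]; rewrite PP.
Qed.

End BidualLimit.

(** * Dyadic martingales and Lindenstrauss' lifting *)

Section DyadicTree.
Context {K : numFieldType}.

(** A word carries its latest letter at the head, so the children of s are [true :: s] and
    [false :: s]. The result is the mean of z over the 2^n descendants of s lying n levels below: a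
    conditional expectation. *)
Fixpoint tree_avg {V : lmodType K} (n : nat) (z : seq bool -> V) (s : seq bool) : V :=
  if n is m.+1 then
    2^-1 *: (tree_avg m z (true :: s) + tree_avg m z (false :: s))
  else z s.

Lemma half_sum (V : lmodType K) (x : V) : 2^-1 *: (x + x) = x.
Proof.
by rewrite scalerDr -scalerDl -[2^-1]mul1r -splitr scale1r.
Qed.

Definition tree_martingale {V : lmodType K} (y : seq bool -> V) :=
  forall s, y s = 2^-1 *: (y (true :: s) + y (false :: s)).

Lemma tree_avg_linear (V W : lmodType K) (f : {linear V -> W}) n z s :
  f (tree_avg n z s) = tree_avg n (fun s => f (z s)) s.
Proof. by elim: n s => //= n ih s; rewrite linearZ linearD /= !ih. Qed.

Lemma tree_avg_eq (V : lmodType K) n (z z' : seq bool -> V) s :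
  (forall s, z s = z' s) -> tree_avg n z s = tree_avg n z' s.
Proof. by move=> zz'; elim: n s => //= n ih s; rewrite !ih. Qed.

Lemma tree_avg_martingale (V : lmodType K) n (y : seq bool -> V) s :
  tree_martingale y -> tree_avg n y s = y s.
Proof. by move=> ym; elim: n s => //= n ih s; rewrite !ih -ym. Qed.

Lemma tree_avg_level (V : lmodType K) n (w : nat -> V) s :
  tree_avg n (fun s => w (size s)) s = w (size s + n)%N.
Proof.
elim: n s => [|n ih] s /=; first by rewrite addn0.
by rewrite !ih/= !addSn addnS half_sum.
Qed.

End DyadicTree.

Section MartingaleLift.
Context {R : realType} {k : scalar_kind}.
Local Notation K := (scalars R k).
Context {V W : normedModType K} (Q : {linear V -> W}).

Lemma rnorm_tree_avg n (z : seq bool -> V) s A :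
  (forall s, rnorm (z s) <= A) -> rnorm (tree_avg n z s) <= A.
Proof.
move=> zA; elim: n s => //= n ih s; rewrite rnorm_half.
have := rnormD (tree_avg n z (true :: s)) (tree_avg n z (false :: s)).
by have := ih (true :: s); have := ih (false :: s); lra.
Qed.

(** For fixed n, the means of z over the descendants of s of length n form a martingale up to level
    n. They differ from [z s] by elements of ker Q, because [Q (z s)] is a martingale; a generalized
    limit of these differences in ker Q corrects z to a martingale without changing its image. *)
Lemma martingale_lift (z : seq bool -> V) (A : R) :
  complemented (range (@bidual_embed R k (subspace_type (kernel_of Q)))) ->
  (forall s, rnorm (z s) <= A) ->
  tree_martingale (fun s => Q (z s)) ->
  exists M : R, exists y, [/\ tree_martingale y, forall s, rnorm (y s) <= M &
    forall s, Q (y s) = Q (z s)].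
Proof.
move=> /complemented_vector_limit[C C0 [L [LD Lle Lcst]]] zA Qm.
have A0 : 0 <= A := le_trans (rnorm_ge0 _) (zA [::]).
have ker n s : tree_avg n z s - z s \in subspace_pred (kernel_of Q).
  by rewrite inE linearB/= tree_avg_linear tree_avg_martingale// subrr.
(* Here n is an absolute level, so that d at s and at its two children involves the same words;
   truncated subtraction makes [d s n] zero for [n <= size s]. *)
pose d s n := SubspaceType (ker (n - size s)%N s).
have dA s n : rnorm (d s n) <= A + A.
  by rewrite (le_trans (rnormB _ _))// lerD// rnorm_tree_avg.
pose y s := z s + val (L (d s)).
have valQ (x : subspace_type (kernel_of Q)) : Q (val x) = 0.
  by have := subspace_valP x; rewrite inE => /eqP.
exists (A + C * (A + A)), y; split => [s|s|s]; last 2 first.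
- by rewrite (le_trans (rnormD _ _))// lerD//; exact: Lle.
- by rewrite linearD /= valQ addr0.
(* The martingale identity for y remains. It rests on writing [d s n] as the mean of d at the two
   children plus the constant c of ker Q. *)
have kerz : 2^-1 *: (z (true :: s) + z (false :: s)) - z s
    \in subspace_pred (kernel_of Q).
  by rewrite inE linearB/= linearZ linearD/= -Qm subrr.
pose c := SubspaceType kerz.
pose h : K := of_real 2^-1.
pose b n := h *: d (false :: s) n + c.
pose a n := h *: d (true :: s) n + b n.
have hA e n : rnorm (h *: d (e :: s) n) <= A.
  by rewrite rnormZ ger0_norm ?invr_ge0//; have := dA (e :: s) n; lra.
have bA n : rnorm (b n) <= A + rnorm c by rewrite (le_trans (rnormD _ _))// lerD.
have aA n : rnorm (a n) <= A + (A + rnorm c).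
  by rewrite (le_trans (rnormD _ _))// lerD.
have La : L a = h *: L (d (true :: s)) + (h *: L (d (false :: s)) + c).
  rewrite (LD _ _ _ _ _ (dA _) bA); congr (_ + _).
  have cc (n : nat) : rnorm c <= rnorm c by [].
  rewrite (LD _ _ _ _ (fun=> c) (dA _) cc); congr (_ + _).
  exact: (Lcst _ 0%N _ _ cc).
(* Below level [size s] a mean from s is the mean of the means from its children, so [a n] and
   [d s n] agree eventually and have the same generalized limit. *)
have ad n : (size s < n)%N -> of_real (-1) *: a n + d s n = 0.
  move=> sn; rewrite of_realN of_real1 scaleN1r; apply/eqP.
  rewrite addrC subr_eq0; apply/eqP/val_inj => /=.
  have -> : (n - size s = (n - (size s).+1).+1)%N by rewrite subnSK.
  rewrite /= /h of_realV2 [RHS]addrA -scalerDr [RHS]addrA -scalerDr.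
  by congr (_ *: _ - _); rewrite addrACA !subrK.
have adA n : rnorm (of_real (-1) *: a n + d s n) <= A + (A + rnorm c) + (A + A).
  by rewrite (le_trans (rnormD _ _))// lerD// rnormZ normrN1 mul1r.
have := Lcst 0 (size s).+1 _ _ adA ad.
rewrite (LD _ _ _ _ _ aA (dA _)) of_realN of_real1 scaleN1r addrC => /eqP.
rewrite subr_eq0 /y => /eqP ->; rewrite La /= /h of_realV2.
set p := val (L _); set q := val (L _).
rewrite [LHS]addrC -!addrA addNr addr0 -!scalerDr; congr (_ *: _).
by rewrite [RHS]addrCA; congr (_ + _); rewrite [LHS]addrC -addrA.
Qed.

End MartingaleLift.

(** * Completeness, Baire category and the open mapping theorem *)

Section Completeness.
Context {R : realType} {k : scalar_kind}.
Local Notation K := (scalars R k).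

(** Completeness stated through sequences with geometrically small increments, the form in which it
    is both proved for L1 and applied. *)
Definition rcomplete (V : normedModType K) := forall (M : R) (u : nat -> V),
  (forall n, rnorm (u n.+1 - u n) <= M * 2^-1 ^+ n) ->
  exists l, forall e : R, 0 < e -> exists N, forall n, (N <= n)%N ->
    rnorm (l - u n) <= e.

Lemma rcomplete_limit (V : normedModType K) (u : nat -> V) (r : nat -> R) :
  rcomplete V -> (forall n, rnorm (u n.+1 - u n) <= r n) ->
  (forall n, r n.+1 <= r n * 2^-1) ->
  exists l, forall n, rnorm (l - u n) <= 2 * r n.
Proof.
move=> cV ur rr; have r0 n : 0 <= r n by rewrite (le_trans _ (ur n)) ?rnorm_ge0.
have [n|l lu] := cV (r 0%N) u.
  rewrite (le_trans (ur n))//; elim: n => [|n ih]; first by rewrite expr0 mulr1.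
  by rewrite (le_trans (rr n))// exprSr mulrA ler_wpM2r// invr_ge0.
(* As r at least halves at each step, [r n <= 2 * (r n - r n.+1)], and the bounds on the increments
   telescope. *)
have tail m n : rnorm (u (m + n)%N - u m) <= 2 * (r m - r (m + n)%N).
  elim: n => [|n ih]; first by rewrite addn0 !subrr rnorm0 mulr0.
  have -> : u (m + n.+1)%N - u m = (u (m + n).+1 - u (m + n)%N) + (u (m + n)%N - u m).
    by rewrite addnS addrA subrK.
  rewrite (le_trans (rnormD _ _))//.
  have := ur (m + n)%N; have := rr (m + n)%N; move: ih; rewrite addnS; lra.
exists l => m; apply/ler_addgt0Pr => e /lu[N lN].
have := lN (m + N)%N (leq_addl _ _); have := tail m N; have := r0 (m + N)%N.
have := rnormD (l - u (m + N)%N) (u (m + N)%N - u m).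
rewrite addrA subrK; lra.
Qed.

Lemma geometric_small (M e : R) : 0 < e -> exists N, forall n, (N <= n)%N ->
  M * 2^-1 ^+ n <= e.
Proof.
move=> e0.
have /cvgrPdist_le/(_ _ e0)[N _ NP] : (fun n => M * 2^-1 ^+ n) @ \oo --> 0.
  rewrite -(mulr0 M); apply: cvgMr; apply: cvg_expr.
  by rewrite ger0_norm ?invr_ge0// invf_lt1 ?ltr1n.
exists N => n /NP; rewrite sub0r normrN; exact/le_trans/ler_norm.
Qed.

Lemma completeNormedMod_rcomplete (V : completeNormedModType K) : rcomplete V.
Proof.
move=> M u uM; have M0 : 0 <= M.
  by have := uM 0%N; rewrite expr0 mulr1; apply: le_trans; exact: rnorm_ge0.
have tail m n : rnorm (u (m + n)%N - u m) <= 2 * M * (2^-1 ^+ m - 2^-1 ^+ (m + n)).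
  elim: n => [|n ih]; first by rewrite addn0 !subrr rnorm0 mulr0.
  have -> : u (m + n.+1)%N - u m = (u (m + n).+1 - u (m + n)%N) + (u (m + n)%N - u m).
    by rewrite addnS addrA subrK.
  rewrite (le_trans (rnormD _ _))//.
  have := uM (m + n)%N; move: ih; rewrite addnS exprS.
  by move: (2^-1 ^+ _) (2^-1 ^+ _) => a b; lra.
have tail2 m n : (m <= n)%N -> rnorm (u n - u m) <= 2 * M * 2^-1 ^+ m.
  move=> /subnKC <-; rewrite (le_trans (tail _ _))// ler_wpM2l ?mulr_ge0//.
  by rewrite gerBl exprn_ge0// invr_ge0.
have /cauchy_cvg/cvg_ex[l ul] : cauchy (u @ \oo).
  apply/cauchy_exP => e e0; have re0 : 0 < re e.
    by rewrite -(@ltr_of_real R k) of_real0 ge0_reK ?ltW.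
  have re20 : 0 < re e / 2 by rewrite divr_gt0.
  have [N NP] := geometric_small (2 * M) re20.
  exists (u N); exists N => // n /= Nn; rewrite -ball_normE /ball_/=.
  rewrite normE -[ltRHS]ge0_reK ?ltW// ltr_of_real rnormC.
  by rewrite (le_lt_trans (tail2 _ _ Nn))// (le_lt_trans (NP _ (leqnn _)))//; lra.
exists l => e e0; have [|N _ NP] := (cvgrPdist_le _ _).1 ul (of_real e : K).
  by rewrite -of_real0 ltr_of_real.
by exists N => n /NP; rewrite normE ler_of_real.
Qed.

(** Some [A n] is dense in a ball. Otherwise every ball contains a point at positive distance from
    [A n], and successive choices converge to a point outside all [A n]. *)
Lemma Baire_cover (W : normedModType K) (A : nat -> set W) : rcomplete W ->
  (forall y, exists n, A n y) ->
  exists n y0 (r : R), 0 < r /\ forall y, rnorm (y - y0) <= r ->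
    forall e : R, 0 < e -> exists2 a, A n a & rnorm (y - a) < e.
Proof.
move=> cW Acov; apply: contrapT => noball.
have step (p : nat * W * R) : exists q : W * R, 0 < p.2 ->
    [/\ rnorm (q.1 - p.1.2) <= p.2, 0 < q.2 &
      forall a, A p.1.1 a -> q.2 <= rnorm (q.1 - a)].
  move: p => [[n y0] r]/=; have [r0|] := ltP 0 r; last by exists (y0, r).
  apply: contrapT => noq; apply: noball; exists n, y0, r; split => // y yr e e0.
  apply: contrapT => noa; apply: noq; exists (y, e) => _; split => //= a Aa.
  by rewrite leNgt; apply/negP => ya; apply: noa; exists a.
have [f fP] := choice step.
(* Halving the radii puts the limit within twice the radius of each centre. The bound [q.2 / 4]
   makes this at most [q.2 / 2], while points of [A n] are at distance at least [q.2]. *)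
pose fix c n := if n is m.+1 then
  let q := f (m, (c m).1, (c m).2) in (q.1, Num.min (q.2 / 4) ((c m).2 / 2))
  else (0, 1) : W * R.
have c0 n : 0 < (c n).2.
  elim: n => [|n ih] //=; have [_ q0 _] := fP (n, (c n).1, (c n).2) ih.
  by rewrite lt_min !divr_gt0.
have [n|n|l lc] := @rcomplete_limit W (fun n => (c n).1) (fun n => (c n).2) cW.
- by have [] := fP (n, (c n).1, (c n).2) (c0 n).
- by rewrite /= ge_min lexx orbT.
have [n Anl] := Acov l.
have [_ q0 /(_ _ Anl)] := fP (n, (c n).1, (c n).2) (c0 n).
have := lc n.+1; rewrite /= rnormC => /[swap] /le_trans/[apply].
set q := (f _).2 in q0 *; move=> h.
have : Num.min (q / 4) ((c n).2 / 2) <= q / 4 by rewrite ge_min lexx.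
by move: h; lra.
Qed.

Theorem open_mapping (V W : normedModType K) (Q : {linear V -> W}) :
  rcomplete V -> rcomplete W -> bounded_op Q -> (forall y, exists x, Q x = y) ->
  exists2 C : R, 0 <= C & forall y, exists2 x, Q x = y & rnorm x <= C * rnorm y.
Proof.
move=> cV cW /bounded_op_rnorm[B B0 QB] Qsurj.
have [y|n [y0 [r [r0 ball_y0]]]] :=
    @Baire_cover W (fun n => [set Q x | x in [set x | rnorm x <= n%:R]]) cW.
  have [x <-] := Qsurj y; exists (Num.truncn (rnorm x)).+1, x => //=.
  exact/ltW/truncnS_gt.
(* A vector of norm r is a difference of two points of the ball around y0. Each is approximated by
   the image of a vector of norm at most n, and scaling from r to [rnorm y] gives this constant. *)
pose C := 2 * n%:R / r.
have C0 : 0 <= C by rewrite divr_ge0 ?mulr_ge0 // ltW.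
have almost y e : 0 < e -> exists2 x, rnorm x <= C * rnorm y & rnorm (y - Q x) <= e.
  move=> e0; have [->|y_neq0] := eqVneq y 0.
    exists 0; first by rewrite rnorm0 mulr_ge0// rnorm_ge0.
    by rewrite linear0 subrr rnorm0 ltW.
  have ny0 : 0 < rnorm y.
    by rewrite lt_neqAle rnorm_ge0 andbT; apply: contra_neq y_neq0 => /esym/rnorm_eq0.
  pose t := rnorm y / r; have t0 : 0 < t by rewrite divr_gt0.
  have ty : y = of_real t *: (of_real t^-1 *: y).
    by rewrite scalerA -of_realM divff ?gt_eqF// of_real1 scale1r.
  have e20 : 0 < e / t / 2 by rewrite !divr_gt0.
  have [|_ [x1 x1n <-] x1P] := ball_y0 (y0 + of_real t^-1 *: y) _ _ e20.
    rewrite addrAC subrr add0r rnormZ gtr0_norm ?invr_gt0// invf_div.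
    by rewrite mulrVK ?unitfE ?gt_eqF// lexx.
  have [|_ [x2 x2n <-] x2P] := ball_y0 y0 _ _ e20; first by rewrite subrr rnorm0 ltW.
  exists (of_real t *: (x1 - x2)).
    have -> : C * rnorm y = t * (2 * n%:R) by rewrite /C /t; ring.
    rewrite rnormZ gtr0_norm// ler_pM2l//.
    by rewrite (le_trans (rnormB _ _))// mulr_natl mulr2n lerD.
  rewrite {1}ty [Q (_ *: _)]linearZ/= -scalerBr rnormZ gtr0_norm// linearB/=.
  rewrite -ler_pdivlMl// [t^-1 * _]mulrC.
  have -> : of_real t^-1 *: y - (Q x1 - Q x2) =
      (y0 + of_real t^-1 *: y - Q x1) - (y0 - Q x2).
    rewrite !opprB -[y0 + _ - _]addrA [y0 + (_ - _)]addrC addrACA subrr addr0.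
    by rewrite -addrA [_ + Q x2]addrC.
  by have := rnormB (y0 + of_real t^-1 *: y - Q x1) (y0 - Q x2); lra.
exists (2 * C) => [|y]; first by rewrite mulr_ge0.
have [->|y_neq0] := eqVneq y 0.
  by exists 0; rewrite ?linear0// !rnorm0 mulr0.
have ny0 : 0 < rnorm y.
  by rewrite lt_neqAle rnorm_ge0 andbT; apply: contra_neq y_neq0 => /esym/rnorm_eq0.
(* The error halves at each correction, so the corrections have norm at most [C * err m] and add up
   to at most [2 * C * rnorm y]. *)
pose err n := rnorm y * 2^-1 ^+ n.
have err0 m : 0 < err m by rewrite mulr_gt0// exprn_gt0// invr_gt0.
have step (p : nat * V) : exists q : V,
    rnorm (q - p.2) <= C * rnorm (y - Q p.2) /\ rnorm (y - Q q) <= err p.1.+1.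
  have [x xC xe] := almost (y - Q p.2) _ (err0 p.1.+1).
  by exists (p.2 + x); rewrite addrAC subrr add0r linearD opprD addrA.
have [f fP] := choice step.
pose fix u m := if m is j.+1 then f (j, u j) else 0 : V.
have uerr m : rnorm (y - Q (u m)) <= err m.
  case: m => [|m]; last exact: (fP (m, u m)).2.
  by rewrite /= linear0 subr0 /err expr0 mulr1.
have [m|m|l lu] := @rcomplete_limit V u (fun m => C * err m) cV.
- by rewrite (le_trans (fP (m, u m)).1)// ler_wpM2l//; exact: uerr.
- by rewrite /err exprSr !mulrA.
exists l; last first.
  by have := lu 0%N; rewrite subr0 /err expr0 mulr1 mulrA.
apply/esym/eqP; rewrite -subr_eq0; apply/eqP/rnorm_small => e e0.
(* The constant collects [err N] from y - Q (u N) and [B * (2 * (C * err N))] from Q (l - u N). *)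
have [N /(_ _ (leqnn _)) NP] := geometric_small ((2 * (B * C) + 1) * rnorm y) e0.
apply: le_trans NP; rewrite -mulrA -/(err N).
have -> : y - Q l = (y - Q (u N)) - Q (l - u N) by rewrite linearB opprB addrA subrK.
have := rnormB (y - Q (u N)) (Q (l - u N)); have := uerr N.
have := ler_wpM2l B0 (lu N); have := QB (l - u N).
have -> : B * (2 * (C * err N)) = 2 * (B * C) * err N by ring.
by rewrite mulrDl mul1r; lra.
Qed.

End Completeness.

(** * Completeness of L1 *)

Section IntegrableSeries.
Context {R : realType} {d : measure_display} {T : measurableType d}.
Variable mu : {measure set T -> \bar R}.

Lemma integral_EFin (f : T -> R) : mu.-integrable setT (EFin \o f) ->
  (\int[mu]_x (f x)%:E = (\int[mu]_x f x)%:E)%E.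
Proof. by move=> fi; rewrite /Rintegral fineK//; exact: integrable_fin_num. Qed.

(** The Riesz-Fischer argument: the sum B of the absolute values is integrable, hence finite almost
    everywhere, so the series converges absolutely there, and B dominates the partial sums. *)
Lemma integrable_series_cvg (a : nat -> T -> R) (M : R) :
  (forall i, mu.-integrable setT (EFin \o a i)) ->
  (forall i, \int[mu]_x `|a i x| <= M * 2^-1 ^+ i) ->
  exists2 F : T -> R, mu.-integrable setT (EFin \o F) &
    forall e : R, 0 < e -> exists N, forall n, (N <= n)%N ->
      \int[mu]_x `|F x - \sum_(i < n) a i x| <= e.
Proof.
move=> ai aM; pose s n x := \sum_(i < n) a i x.
have s_int n : mu.-integrable setT (EFin \o s n).
  rewrite (_ : _ \o _ = fun x => \sum_(i < n) (a i x)%:E)%E.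
    by apply: integrable_sum => // i _; exact: ai.
  by apply/funext => x /=; rewrite sumEFin.
have ma i : measurable_fun setT (a i) by apply/measurable_EFinP; exact: measurable_int (ai i).
have mabs i : measurable_fun setT (fun x => `|a i x|%:E).
  by apply/measurable_EFinP; exact: measurableT_comp.
pose B x := (\sum_(i <oo) `|a i x|%:E)%E.
have Bint : (\int[mu]_x B x <= (2 * M)%:E)%E.
  rewrite integral_nneseries//.
  apply: lime_le.
    by apply: is_cvg_nneseries => n _ _; apply: integral_ge0.
  apply: nearW => n; rewrite (eq_bigr (fun i => (\int[mu]_x `|a i x|)%:E)); last first.
    by move=> i _; rewrite integral_EFin//; exact: integrable_norm.
  rewrite sumEFin lee_fin big_mkord.
  have M0 : 0 <= M.
    by have := aM 0%N; rewrite expr0 mulr1; apply: le_trans; apply: Rintegral_ge0.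
  suff : \sum_(i < n) \int[mu]_x `|a i x| <= 2 * M * (1 - 2^-1 ^+ n).
    have : 0 <= 2^-1 ^+ n :> R by rewrite exprn_ge0// invr_ge0.
    by move=> n0 /le_trans; apply; rewrite ler_piMr ?mulr_ge0// gerBl.
  elim: n => [|n ih]; first by rewrite big_ord0 expr0 subrr mulr0.
  by rewrite big_ord_recr/= exprS; have := aM n; move: ih; lra.
have B0 x : (0 <= B x)%E by apply: nneseries_ge0 => *; rewrite lee_fin.
have mB : measurable_fun setT B by apply: ge0_emeasurable_sum.
have iB : mu.-integrable setT B.
  apply/integrableP; split => //.
  under eq_integral do rewrite gee0_abs//.
  exact: le_lt_trans Bint (ltry _).
(* The upper limit is measurable on all of T and equals the sum wherever the series converges. *)
pose f x := limn_esup (fun n => (s n x)%:E).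
have sf : {ae mu, forall x, setT x -> (fun n => (s n x)%:E) @ \oo --> f x}.
  have := integrable_ae measurableT iB; apply: filterS => x /(_ I) Bfin _.
  have : cvgn [normed series (fun i => a i x)].
    apply: nondecreasing_is_cvgn; first by apply: nondecreasing_series => i _ _ /=.
    exists (fine (B x)) => _ [n _ <-]; rewrite -lee_fin fineK// /series/= -sumEFin.
    by apply: nneseries_lim_ge => *; rewrite lee_fin.
  move=> /normed_cvg/cvg_ex[l sl].
  have sEl : (fun n => (s n x)%:E) @ \oo --> l%:E.
    apply: cvg_EFin; first exact: nearW.
    by move: sl; rewrite /series/= /s; under [X in X @ _]eq_fun do rewrite big_mkord.
  by rewrite /f (cvg_limn_einf_sup sEl).2.
have sB : {ae mu, forall x n, setT x -> (`|(s n x)%:E| <= B x)%E}.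
  apply: aeW => x n _ /=; apply: (@le_trans _ _ (\sum_(0 <= i < n) `|a i x|%:E)%E).
    by rewrite sumEFin lee_fin big_mkord; exact: ler_norm_sum.
  by apply: nneseries_lim_ge => *; rewrite lee_fin.
have ms n : measurable_fun setT (fun x => (s n x)%:E) by exact: measurable_int (s_int n).
have mf : measurable_fun setT f by apply: measurable_fun_limn_esup.
have [fi sf0 _] := dominated_convergence measurableT ms mf sf iB sB.
(* [fine] alters f only on the null set where it is infinite. *)
exists (fine \o f).
  apply: (le_integrable measurableT _ _ fi).
    by apply/measurable_EFinP; exact: measurableT_comp mf.
  by move=> x _ /=; case: (f x) => [r| |] //=; rewrite ?normr0 leey.
have fE n : \int[mu]_x `|fine (f x) - s n x| =
    fine (\int[mu]_x `|(s n x)%:E - f x|)%E.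
  congr fine; apply: ge0_ae_eq_integral => //.
  - apply/measurable_EFinP/measurableT_comp => //.
    apply: measurable_funB; first exact: measurableT_comp mf.
    by apply/measurable_EFinP; exact: ms.
  - by apply: measurableT_comp => //; exact: emeasurable_funB.
  have := integrable_ae measurableT fi; apply: filterS => x /(_ I) fx _.
  by rewrite -[in RHS](fineK fx) /= distrC.
move=> e e0; move/fine_cvg : sf0 => /cvgrPdist_le/(_ _ e0)[N _ NP].
exists N => n /NP; rewrite fE /= sub0r normrN; exact/le_trans/ler_norm.
Qed.

End IntegrableSeries.

Section L1Theory.
Context {R : realType} {k : scalar_kind} {d : measure_display} {T : measurableType d}.
Variable mu : {measure set T -> \bar R}.
Local Notation K := (scalars R k).
Local Notation L1mu := (L1 k mu).
Local Notation intfun := (@integrable_fun R k d T mu).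
Implicit Types (f g : intfun).

Definition fun_norm f : R := \int[mu]_x re `|f x|.

Lemma rnorm_L1_class f : rnorm (L1_class f) = fun_norm f.
Proof. by rewrite /rnorm -[`|_|]/(L1_norm _) L1_norm_class of_realK. Qed.

Lemma rnorm_L1_repr (q : L1mu) : fun_norm (L1_repr q) = rnorm q.
Proof. by rewrite -rnorm_L1_class L1_reprK. Qed.

Lemma integrable_re f : mu.-integrable setT (EFin \o (re \o f)).
Proof. by have := integrable_valP f; rewrite inE => -[]. Qed.

Lemma integrable_im f : mu.-integrable setT (EFin \o (im \o f)).
Proof. by have := integrable_valP f; rewrite inE => -[]. Qed.

Lemma re_norm_ge0 (a : K) : 0 <= re `|a|.
Proof. by rewrite re_norm sqrtr_ge0. Qed.

Lemma fun_norm_ge0 f : 0 <= fun_norm f.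
Proof. by apply: Rintegral_ge0 => x _; exact: re_norm_ge0. Qed.

Lemma integrable_fun0E x : (0 : intfun) x = 0.
Proof. by []. Qed.

Lemma integrable_funDE f g x : (f + g) x = f x + g x.
Proof. by []. Qed.

Lemma integrable_funNE f x : (- f) x = - f x.
Proof. by []. Qed.

Lemma integrable_funZE (a : K) f x : (a *: f) x = a * f x.
Proof. by []. Qed.

Lemma integrable_fun_sumE n (f : nat -> intfun) x :
  (\sum_(i < n) f i) x = \sum_(i < n) f i x.
Proof.
by elim: n => [|n ih]; rewrite ?big_ord0// !big_ord_recr integrable_funDE ih.
Qed.

Lemma im_cart_sub x y : `|im (cart x y : K)| <= `|y|.
Proof. by rewrite /im /cart; case: k => //=; rewrite normr0. Qed.

(** The series argument is applied to the real and imaginary parts of representatives of the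
    increments, and [cart] recombines the two sums. *)
Lemma L1_rcomplete : rcomplete L1mu.
Proof.
move=> M u uM; pose f i := L1_repr (u i.+1 - u i).
have fM i : fun_norm (f i) <= M * 2^-1 ^+ i by rewrite rnorm_L1_repr.
have reM' i : \int[mu]_x `|re (f i x)| <= M * 2^-1 ^+ i.
  apply: le_trans (fM i); apply: le_Rintegral => //.
  - exact: integrable_norm (integrable_re _).
  - exact: integrable_re_norm.
  - by move=> x _; exact: norm_re_le.
have imM' i : \int[mu]_x `|im (f i x)| <= M * 2^-1 ^+ i.
  apply: le_trans (fM i); apply: le_Rintegral => //.
  - exact: integrable_norm (integrable_im _).
  - exact: integrable_re_norm.
  - by move=> x _; exact: norm_im_le.
have [Fr iFr FrP] := integrable_series_cvg (fun i => integrable_re (f i)) reM'.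
have [Fi iFi FiP] := integrable_series_cvg (fun i => integrable_im (f i)) imM'.
have iF : (fun x => cart (Fr x) (Fi x)) \in @integrable_pred R k d T mu.
  rewrite inE; split.
    rewrite (_ : _ \o _ = EFin \o Fr)//.
    by apply/funext => x /=; rewrite re_cart.
  apply: (le_integrable measurableT _ _ iFi).
    apply/measurable_EFinP; have /measurable_EFinP mFi := measurable_int _ iFi.
    rewrite /cart /im; case: (k) => /=; first exact: measurable_cst.
    exact: mFi.
  by move=> x _ /=; rewrite lee_fin; exact: im_cart_sub.
pose g : intfun := IntegrableFun iF.
exists (L1_class g + u 0%N) => e e0.
have e20 : 0 < e / 2 by rewrite divr_gt0.
have [N1 N1P] := FrP _ e20; have [N2 N2P] := FiP _ e20.
exists (maxn N1 N2) => n; rewrite geq_max => /andP[/N1P r1 /N2P r2].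
have uE : u n = u 0%N + L1_class (\sum_(i < n) f i).
  elim: n {r1 r2} => [|n ih]; first by rewrite big_ord0 L1_class0 addr0.
  by rewrite big_ord_recr /= L1_classD L1_reprK addrA -ih addrC subrK.
have -> : L1_class g + u 0%N - u n = L1_class (g - \sum_(i < n) f i).
  rewrite uE opprD addrA addrK L1_classD; congr (_ + _).
  by rewrite -[in RHS]scaleN1r L1_classZ scaleN1r.
rewrite rnorm_L1_class /fun_norm.
have int1 (F : T -> R) (a : nat -> T -> R) : mu.-integrable setT (EFin \o F) ->
    (forall i, mu.-integrable setT (EFin \o a i)) ->
    mu.-integrable setT (EFin \o (fun x => `|F x - \sum_(i < n) a i x|)).
  move=> iF' ia; apply: integrable_norm.
  rewrite (_ : _ \o _ = (EFin \o F \- fun x => \sum_(i < n) (a i x)%:E)%E).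
    by apply: integrableB => //; apply: integrable_sum => // i _; exact: ia.
  by apply/funext => x /=; rewrite sumEFin.
have ir := int1 _ _ iFr (fun i => integrable_re (f i)).
have ii := int1 _ _ iFi (fun i => integrable_im (f i)).
have -> : e = e / 2 + e / 2 by rewrite -splitr.
apply: le_trans (lerD r1 r2); rewrite -RintegralD//.
apply: le_Rintegral => //.
- exact: integrable_re_norm.
- exact: (integrableD measurableT ir ii).
move=> x _; rewrite integrable_funDE integrable_funNE integrable_fun_sumE.
rewrite -[X in _ - X]cart_re_im (big_morph re (@reD _ _) re0) (big_morph im (@imD _ _) im0).
have cartB (a b c e' : R) : cart a b - cart c e' = cart (a - c) (b - e') :> K.
  by rewrite /cart; case: (k).
by rewrite cartB; exact: cart_norm_le.
Qed.

End L1Theory.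

(** * Convex blocks and the parallelogram law *)

Section ConvexBlocks.
Context {R : realType}.

(* A polynomial stands for the finite sequence of its coefficients. *)
Definition convex_block (N : nat) (u : {poly R}) :=
  [/\ forall i, 0 <= u`_i, u.[1] = 1 & forall i, (i < N)%N -> u`_i = 0].

Lemma convex_blockXn N : convex_block N 'X^N.
Proof.
split => [i||i iN]; first by rewrite coefXn; case: eqP.
  by rewrite hornerXn expr1n.
by rewrite coefXn ltn_eqF.
Qed.

Lemma convex_block_leq M N u : (M <= N)%N -> convex_block N u -> convex_block M u.
Proof. by move=> MN [u0 u1 uN]; split=> // i iM; apply: uN; exact: leq_trans MN. Qed.

Lemma convex_block_mid N u v : convex_block N u -> convex_block N v ->
  convex_block N (2^-1 *: (u + v)).
Proof.
move=> [u0 u1 uN] [v0 v1 vN]; split => [i||i iN].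
- by rewrite coefZ coefD mulr_ge0 ?addr_ge0// invr_ge0.
- by rewrite hornerZ hornerD u1 v1; lra.
- by rewrite coefZ coefD uN// vN// addr0 mulr0.
Qed.

(** The infimum [d n] of p over convex blocks beyond n increases to a finite D. For large n two
    almost minimal blocks have their midpoint among the competitors, so the parallelogram inequality
    forces p of their difference to be small, as in the uniqueness of nearest points in Hilbert
    space. *)
Lemma convex_blocks_close (p : {poly R} -> R) (C : R) :
  (forall u, 0 <= p u) ->
  (forall u v, p (u + v) ^+ 2 + p (u - v) ^+ 2 <= 2 * p u ^+ 2 + 2 * p v ^+ 2) ->
  (forall u, p (2^-1 *: u) = 2^-1 * p u) ->
  (forall u, convex_block 0 u -> p u <= C) ->
  forall N e, 0 < e -> exists u v,
    [/\ convex_block N u, convex_block (size u) v & p (u - v) <= e].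
Proof.
move=> p0 ppar pZ pC N e e0.
pose S n := [set p u | u in convex_block n].
have S0 n : S n !=set0 by exists (p 'X^n); exists 'X^n => //; exact: convex_blockXn.
have lbS n : lbound (S n) 0 by move=> _ [u _ <-].
have infS n : has_inf (S n) by split => //; exists 0; exact: lbS.
pose d n := inf (S n).
have d0 n : 0 <= d n by apply: lb_le_inf.
have dle n u : convex_block n u -> d n <= p u.
  by move=> nu; apply: ge_inf; [exists 0|exists u].
have d_nd m n : (m <= n)%N -> d m <= d n.
  move=> mn; apply: lb_le_inf => // _ [u nu <-]; apply: dle.
  exact: convex_block_leq nu.
have dC n : d n <= C.
  rewrite (le_trans (dle _ _ (convex_blockXn n)))// pC//.
  exact: convex_block_leq (convex_blockXn n).
have supd : has_sup (range d) by split; [exists (d 0%N), 0%N|exists C => _ [n _ <-]].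
pose D := sup (range d).
have dD n : d n <= D by apply: ub_le_sup; [exact: supd.2|exists n].
have D0 : 0 <= D := le_trans (d0 0%N) (dD 0%N).
(* With p u and p v below D + t, the inequality gives p (u - v)^2 <= 4 ((D + t)^2 - d n ^2). Since D
   - t < d n <= D and t <= 1, this is at most 8 t (2 D + 1). *)
pose t := Num.min 1 (e ^+ 2 / (8 * (2 * D + 1))).
have t0 : 0 < t.
  by rewrite lt_min ltr01/= divr_gt0 ?exprn_gt0// mulr_gt0// ltr_wpDl// mulr_ge0.
have t1 : t <= 1 by rewrite ge_min lexx.
have te : 8 * t * (2 * D + 1) <= e ^+ 2.
  rewrite -mulrA mulrCA -ler_pdivlMr; first by rewrite ge_min lexx orbT.
  by rewrite mulr_gt0// ltr_wpDl// mulr_ge0.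
have [_ [n0 _ <-] Dn0] := sup_adherent t0 supd.
pose n := maxn N n0.
have dn : D - t < d n by rewrite (lt_le_trans Dn0)// d_nd// leq_maxr.
have near_inf m : exists2 u, convex_block m u & p u < D + t.
  have [_ [u mu <-] um] := inf_adherent t0 (infS m).
  by exists u => //; rewrite (lt_le_trans um)// lerD2r; exact: dD.
have [u nu uD] := near_inf n.
(* v starts after the end of u but also beyond n, so that the midpoint is a block beyond n. *)
have [v mv vD] := near_inf (maxn (size u) n).
exists u, v; split.
- by apply: convex_block_leq nu; exact: leq_maxl.
- by apply: convex_block_leq mv; exact: leq_maxl.
have := dle _ _ (convex_block_mid nu (convex_block_leq (leq_maxr _ _) mv)).
rewrite pZ => duv; rewrite -(ler_pXn2r (ltn0Sn 1)) ?nnegrE//; last exact: ltW.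
have Dt0 : 0 <= D + t by rewrite addr_ge0// ltW.
have uD2 : p u ^+ 2 <= (D + t) ^+ 2 by rewrite ler_pXn2r ?nnegrE// ltW.
have vD2 : p v ^+ 2 <= (D + t) ^+ 2 by rewrite ler_pXn2r ?nnegrE// ltW.
have uv2 : (2 * d n) ^+ 2 <= p (u + v) ^+ 2.
  by rewrite ler_pXn2r ?nnegrE ?mulr_ge0//; lra.
have key : (D + t) ^+ 2 - d n ^+ 2 <= 2 * t * (2 * D + 1).
  have -> : (D + t) ^+ 2 - d n ^+ 2 = (D + t - d n) * (D + t + d n) by ring.
  by rewrite ler_pM//; have := dD n; have := d0 n; lra.
have := ppar u v; move: uv2; rewrite exprMn; lra.
Qed.

End ConvexBlocks.

Section CoefficientSums.
Context {R : realType}.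

Implicit Types (a : nat -> R) (c : {poly R}).

Definition coef_pair (a : nat -> R) (c : {poly R}) : R := \sum_(i < size c) c`_i * a i.

Lemma coef_pair_widen a c n : (size c <= n)%N -> coef_pair a c = \sum_(i < n) c`_i * a i.
Proof.
move=> cn; rewrite /coef_pair (big_ord_widen n (fun i => c`_i * a i))//.
rewrite big_mkcond; apply: eq_bigr => i _; case: ltnP => // ic.
by rewrite nth_default// mul0r.
Qed.

Lemma coef_pairD a (b c : {poly R}) : coef_pair a (b + c) = coef_pair a b + coef_pair a c.
Proof.
pose n := (size b + size c)%N.
have bn : (size b <= n)%N by exact: leq_addr.
have cn : (size c <= n)%N by exact: leq_addl.
have bcn : (size (b + c)%R <= n)%N.
  by rewrite (leq_trans (size_polyD _ _))// geq_max bn.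
rewrite (coef_pair_widen _ bn) (coef_pair_widen _ cn) (coef_pair_widen _ bcn).
by rewrite -big_split; apply: eq_bigr => i _; rewrite coefD mulrDl.
Qed.

Lemma coef_pairZ a (t : R) c : coef_pair a (t *: c) = t * coef_pair a c.
Proof.
rewrite (coef_pair_widen a (size_scale_leq t c)) /coef_pair mulr_sumr.
by apply: eq_bigr => i _; rewrite coefZ mulrA.
Qed.

Lemma coef_pairB a (b c : {poly R}) : coef_pair a (b - c) = coef_pair a b - coef_pair a c.
Proof. by rewrite coef_pairD -scaleN1r coef_pairZ mulN1r. Qed.

Lemma coef_pair_le a c (M : R) : (forall i, `|a i| <= M) ->
  `|coef_pair a c| <= (\sum_(i < size c) `|c`_i|) * M.
Proof.
move=> aM; rewrite (le_trans (ler_norm_sum _ _ _))// mulr_suml.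
by apply: ler_sum => i _; rewrite normrM ler_wpM2l.
Qed.

(** The pairing is a weighted mean of the a i, as [c.[1]] is the sum of the coefficients. *)
Lemma coef_pair_convex a c N (M : R) : convex_block N c -> (forall i, `|a i| <= M) ->
  `|coef_pair a c| <= M.
Proof.
move=> [c0 c1 _] aM; rewrite (le_trans (coef_pair_le _ aM))//.
rewrite (eq_bigr (fun i : 'I__ => c`_i * 1 ^+ i)) => [|i _].
  by rewrite -horner_coef c1 mul1r.
by rewrite ger0_norm// expr1n mulr1.
Qed.

End CoefficientSums.

(** * Blocks of functionals that are small in the dual of L2 *)

Section SmallBlocks.
Context {R : realType} {k : scalar_kind} {d : measure_display} {T : measurableType d}.
Variable mu : {finite_measure set T -> \bar R}.
Local Notation K := (scalars R k).
Local Notation intfun := (@integrable_fun R k d T mu).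
Implicit Types (f g : intfun).

Definition fun_bounded f := exists M : R, forall x, re `|f x| <= M.

Definition square_integral f : R := \int[mu]_x (re `|f x| ^+ 2).

Lemma square_integral_ge0 f : 0 <= square_integral f.
Proof. by apply: Rintegral_ge0 => x _; exact: sqr_ge0. Qed.

Lemma square_integrable f : fun_bounded f ->
  mu.-integrable setT (EFin \o (fun x => re `|f x| ^+ 2)).
Proof.
move=> [M fM].
apply: (le_integrable measurableT _ _ (finite_measure_integrable_cst mu (M ^+ 2) measurableT)).
  apply/measurable_EFinP; apply: measurable_funX.
  by apply/measurable_EFinP; exact: measurable_int (integrable_re_norm f).
move=> x _ /=; rewrite lee_fin (ger0_norm (sqr_ge0 (re _))) (ger0_norm (sqr_ge0 M)).
have M0 : 0 <= M by rewrite (le_trans _ (fM x))// re_norm_ge0.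
by rewrite ler_pXn2r ?nnegrE ?re_norm_ge0//; exact: fM.
Qed.

Lemma fun_bounded_comb f g (s t : R) : fun_bounded f -> fun_bounded g ->
  fun_bounded (of_real s *: f + of_real t *: g).
Proof.
move=> [M fM] [N gN]; exists (`|s| * M + `|t| * N) => x.
rewrite integrable_funDE !integrable_funZE.
rewrite (le_trans (rnormD (of_real s * f x : K) (of_real t * g x)))// lerD//.
  by rewrite -[_ * _]/(of_real s *: (f x : K)) rnormZ ler_wpM2l//; exact: fM.
by rewrite -[_ * _]/(of_real t *: (g x : K)) rnormZ ler_wpM2l//; exact: gN.
Qed.

Lemma square_integral_parallelogram f g (s t : R) : fun_bounded f -> fun_bounded g ->
  square_integral (of_real s *: f + of_real t *: g) +
  square_integral (of_real s *: f + of_real (- t) *: g) =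
  2 * s ^+ 2 * square_integral f + 2 * t ^+ 2 * square_integral g.
Proof.
move=> bf bg; rewrite /square_integral.
have int1 := square_integrable (fun_bounded_comb s t bf bg).
have int2 := square_integrable (fun_bounded_comb s (- t) bf bg).
have intf := square_integrable bf; have intg := square_integrable bg.
have intZ (h : T -> R) (r : R) : mu.-integrable setT (EFin \o h) ->
  mu.-integrable setT (EFin \o (fun x => r * h x)).
  by move=> ih; exact: (integrableZl measurableT r ih).
rewrite -[LHS](RintegralD measurableT int1 int2).
rewrite -(RintegralZl (2 * s ^+ 2) measurableT intf).
rewrite -(RintegralZl (2 * t ^+ 2) measurableT intg).
rewrite -[RHS](RintegralD measurableT (intZ _ _ intf) (intZ _ _ intg)).
apply: eq_Rintegral => x _; rewrite !integrable_funDE !integrable_funZE.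
rewrite !re_norm !sqr_sqrtr ?addr_ge0 ?sqr_ge0//.
by rewrite !reD !imD !reM !imM !im_of_real !of_realK; ring.
Qed.

(** Pointwise t <= 1 + t^2; thus the L2 unit ball is bounded in L1 for a finite measure. *)
Lemma fun_norm_le_square f : fun_bounded f ->
  fun_norm f <= fine (mu setT) + square_integral f.
Proof.
move=> bf; have <- : \int[mu]_x (cst 1 x : R) = fine (mu setT).
  by rewrite Rintegral_cst// mul1r.
have i1 := finite_measure_integrable_cst mu (1 : R) measurableT.
rewrite -(RintegralD measurableT i1 (square_integrable bf)).
apply: le_Rintegral => //; first exact: integrable_re_norm.
  exact: (integrableD measurableT i1 (square_integrable bf)).
move=> x _ /=; have := sqr_ge0 (re `|f x| - 1); have := re_norm_ge0 (f x).
by rewrite sqrrB mulr1 expr1n -mulr_natl; lra.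
Qed.

Section Functionals.
Variables (phi : nat -> intfun -> R) (C : R).
Hypothesis phi_linear : forall i, real_linear (phi i).
Hypothesis phi_le : forall i f, `|phi i f| <= C * fun_norm f.

Definition combination (c : {poly R}) f : R := coef_pair (phi ^~ f) c.

Lemma combination_linear c : real_linear (combination c).
Proof.
move=> t f g; rewrite /combination /coef_pair mulr_sumr -big_split/=.
by apply: eq_bigr => i _; rewrite phi_linear; ring.
Qed.

Let sqball := [set f | fun_bounded f /\ square_integral f <= 1].

(** The norm of the combination as a functional for the L2 norm, computed on bounded functions. *)
Definition square_dual_norm (c : {poly R}) : R := sup [set combination c f | f in sqball].

Let sqball0 : sqball 0.
Proof.
split; first by exists 0 => x; rewrite integrable_fun0E normr0 re0.
have <- : \int[mu]_x (cst 0 x : R) = square_integral 0.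
  by apply: eq_Rintegral => x _; rewrite integrable_fun0E normr0 re0 expr0n.
by rewrite Rintegral_cst// mul0r.
Qed.

Let sqball_norm f : sqball f -> fun_norm f <= fine (mu setT) + 1.
Proof. by move=> [bf f1]; rewrite (le_trans (fun_norm_le_square bf))// lerD2l. Qed.

Let combination_le c f : sqball f -> combination c f <= square_dual_norm c.
Proof.
move=> Sf; apply: ub_le_sup; last by exists f.
exists ((\sum_(i < size c) `|c`_i|) * (`|C| * (fine (mu setT) + 1))) => _ [g Sg <-].
rewrite (le_trans (ler_norm _))// coef_pair_le// => i.
rewrite (le_trans (phi_le _ _))// (@le_trans _ _ (`|C| * fun_norm g))//.
  by rewrite ler_wpM2r ?fun_norm_ge0// ler_norm.
by rewrite ler_wpM2l// sqball_norm.
Qed.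

Lemma square_dual_norm_ge0 c : 0 <= square_dual_norm c.
Proof. by rewrite -(real_linear0 (combination_linear c)) combination_le. Qed.

Lemma combination_scaled c f (r : R) : 0 < r -> fun_bounded f ->
  square_integral f <= r ^+ 2 -> combination c f <= square_dual_norm c * r.
Proof.
move=> r0 bf fr; rewrite -ler_pdivrMr// mulrC.
rewrite -(real_linearZ (combination_linear c)); apply: combination_le.
(* Seen as a combination with second weight 0, the scaled function has its square integral given by
   the parallelogram law. *)
have fE : of_real r^-1 *: f = of_real r^-1 *: f + of_real 0 *: f.
  by rewrite of_real0 scale0r addr0.
split; first by rewrite fE; exact: fun_bounded_comb.
have := square_integral_parallelogram r^-1 0 bf bf; rewrite oppr0 -fE.
have : r^-1 ^+ 2 * square_integral f <= 1.
  by rewrite exprVn ler_pdivrMl ?exprn_gt0// mulr1.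
by rewrite expr0n /= mulr0 mul0r; lra.
Qed.

(** The bound p sqrt N, for the dual norm p and the square integral N, followed by p sqrt N <= p^2 +
    N / 4. *)
Lemma combination_square c f : fun_bounded f ->
  combination c f <= square_dual_norm c ^+ 2 + square_integral f / 4.
Proof.
move=> bf; set p := square_dual_norm c; set N := square_integral f.
have p0 : 0 <= p := square_dual_norm_ge0 c.
have N0 : 0 <= N := square_integral_ge0 f.
have [N_gt0|] := ltP 0 N.
  have r0 : 0 < Num.sqrt N by rewrite sqrtr_gt0.
  have := combination_scaled c r0 bf; rewrite sqr_sqrtr// lexx => /(_ isT).
  move/le_trans; apply; rewrite -/p -{2}(sqr_sqrtr N0).
  by have := sqr_ge0 (p - Num.sqrt N / 2); rewrite sqrrB; lra.
(* When N = 0 any positive radius is allowed: p itself if p > 0, and 1 if p = 0. *)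
move=> Nle0; have N0' : N = 0 by apply/eqP; rewrite eq_le Nle0.
rewrite N0' mul0r addr0; have [p_gt0|ple0] := ltP 0 p.
  rewrite expr2; apply: combination_scaled => //.
  by rewrite -/N N0' sqr_ge0.
have p_eq0 : p = 0 by apply/eqP; rewrite eq_le ple0.
have := combination_scaled c ltr01 bf; rewrite -/N N0' sqr_ge0 -/p p_eq0 expr0n mul0r.
exact.
Qed.

(** The parallelogram law passes to the dual norm. For f, g in the ball, s (a+b)(f) + t (a-b)(g) =
    a(s f + t g) + b(s f - t g), which [combination_square] and the law for functions bound by B.
    Suprema over f and g give s^2 + t^2 <= B, and half of the left side is absorbed. *)
Lemma square_dual_norm_parallelogram a b :
  square_dual_norm (a + b) ^+ 2 + square_dual_norm (a - b) ^+ 2 <=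
  2 * square_dual_norm a ^+ 2 + 2 * square_dual_norm b ^+ 2.
Proof.
set s := square_dual_norm (a + b); set t := square_dual_norm (a - b).
set pa := square_dual_norm a; set pb := square_dual_norm b.
have s0 : 0 <= s := square_dual_norm_ge0 _.
have t0 : 0 <= t := square_dual_norm_ge0 _.
pose B := pa ^+ 2 + pb ^+ 2 + (s ^+ 2 + t ^+ 2) / 2.
have key f g : sqball f -> sqball g ->
    s * combination (a + b) f + t * combination (a - b) g <= B.
  move=> [bf f1] [bg g1].
  have := combination_square a (fun_bounded_comb s t bf bg).
  have := combination_square b (fun_bounded_comb s (- t) bf bg).
  have := square_integral_parallelogram s t bf bg.
  rewrite !(real_linearD (combination_linear _)) !(real_linearZ (combination_linear _)).
  rewrite /combination coef_pairD coef_pairB -!/(combination _ _) -/pa -/pb.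
  have := ler_wpM2l (sqr_ge0 s) f1; have := ler_wpM2l (sqr_ge0 t) g1.
  rewrite !mulr1 -(mulrA 2 (s ^+ 2)) -(mulrA 2 (t ^+ 2)) mulrDr mulrBr mulNr /B.
  move: (pa ^+ 2) (pb ^+ 2) (s ^+ 2) (t ^+ 2) (s ^+ 2 * _) (t ^+ 2 * _).
  move: (square_integral _) (square_integral _) (s * _) (s * _) (t * _) (t * _).
  by clear => *; lra.
(* The suprema are taken one variable at a time, dividing by the factor t (then s) if it is
   positive; otherwise it is 0 and its term vanishes. *)
have key2 f : sqball f -> s * combination (a + b) f + t * t <= B.
  move=> Sf; have [t_gt0|] := ltP 0 t; last first.
    move=> tle0; have := key f 0 Sf sqball0; have -> : t = 0 by lra.
    by rewrite !mul0r; exact.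
  rewrite -lerBrDl -ler_pdivlMl//; apply: ge_sup.
    by exists (combination (a - b) 0), 0.
  by move=> _ [g Sg <-]; rewrite ler_pdivlMl// lerBrDl; exact: key.
have : s * s + t * t <= B.
  have [s_gt0|] := ltP 0 s; last first.
    move=> sle0; have := key2 0 sqball0; have -> : s = 0 by lra.
    by rewrite !mul0r; exact.
  rewrite -lerBrDr -ler_pdivlMl//; apply: ge_sup.
    by exists (combination (a + b) 0), 0.
  by move=> _ [g Sg <-]; rewrite ler_pdivlMl// lerBrDr; exact: key2.
by rewrite /B !expr2; lra.
Qed.

Lemma small_blocks N (e : R) : 0 < e -> exists u v : {poly R},
  [/\ convex_block N u, convex_block (size u) v &
    forall f r, 0 < r -> fun_bounded f -> square_integral f <= r ^+ 2 ->
      combination (u - v) f <= e * r].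
Proof.
(* The last constant bounds every [phi i] on the L2 ball, hence also their weighted means; the
   absolute value is taken because the sign of C is not fixed. *)
move=> e0; have [||||u [v [Nu uv pe]]] :=
    @convex_blocks_close R square_dual_norm (`|C| * (fine (mu setT) + 1)) _ _ _ _ N e e0.
- exact: square_dual_norm_ge0.
- exact: square_dual_norm_parallelogram.
- move=> u; rewrite /square_dual_norm.
  have combZ f : combination (2^-1 *: u) f = 2^-1 * combination u f.
    by rewrite /combination coef_pairZ.
  apply/eqP; rewrite eq_le; apply/andP; split.
    apply: ge_sup; first by exists (combination (2^-1 *: u) 0), 0.
    by move=> _ [f Sf <-]; rewrite combZ ler_wpM2l ?invr_ge0//; exact: combination_le.
  rewrite -ler_pdivlMl ?invr_gt0// invrK; apply: ge_sup.
    by exists (combination u 0), 0.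
  move=> _ [f Sf <-]; have := combination_le (2^-1 *: u) Sf; rewrite combZ.
  by rewrite -/(square_dual_norm _); lra.
- move=> u cu; apply: ge_sup; first by exists (combination u 0), 0.
  move=> _ [f Sf <-]; rewrite (le_trans (ler_norm _))//.
  apply: (coef_pair_convex cu) => i; rewrite (le_trans (phi_le _ _))//.
  rewrite (@le_trans _ _ (`|C| * fun_norm f))//.
    by rewrite ler_wpM2r ?fun_norm_ge0// ler_norm.
  by rewrite ler_wpM2l// sqball_norm.
exists u, v; split => // f r r0 bf fr.
by rewrite (le_trans (combination_scaled _ r0 bf fr))// ler_pM2r.
Qed.

End Functionals.
End SmallBlocks.

(** * Domination of the averaged martingale differences *)

Section Domination.
Context {R : realType} {k : scalar_kind} {d : measure_display} {T : measurableType d}.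
Local Notation K := (scalars R k).

Section AnyMeasure.
Variable mu : {measure set T -> \bar R}.
Local Notation intfun := (@integrable_fun R k d T mu).
Implicit Types (f g : intfun).

Lemma truncation_integrable f (N : R) :
  (fun x => if re `|f x| <= N then f x else 0) \in @integrable_pred R k d T mu.
Proof.
have mle : measurable_fun setT (fun x => re `|f x| <= N).
  apply: measurable_fun_ler; last exact: measurable_cst.
  by apply/measurable_EFinP; exact: measurable_int (integrable_re_norm f).
rewrite inE; split.
  apply: (le_integrable measurableT _ _ (integrable_re f)).
    apply/measurable_EFinP.
    rewrite (_ : _ \o _ = fun x => if re `|f x| <= N then re (f x) else 0).
      apply: measurable_fun_ifT => //; apply/measurable_EFinP.
      exact: measurable_int (integrable_re f).
    by apply/funext => x /=; case: ifP => // _; rewrite re0.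
  by move=> x _ /=; rewrite lee_fin; case: ifP => // _; rewrite re0 normr0.
apply: (le_integrable measurableT _ _ (integrable_im f)).
  apply/measurable_EFinP.
  rewrite (_ : _ \o _ = fun x => if re `|f x| <= N then im (f x) else 0).
    apply: measurable_fun_ifT => //; apply/measurable_EFinP.
    exact: measurable_int (integrable_im f).
  by apply/funext => x /=; case: ifP => // _; rewrite im0.
by move=> x _ /=; rewrite lee_fin; case: ifP => // _; rewrite im0 normr0.
Qed.

Definition truncation f N : intfun := IntegrableFun (truncation_integrable f N).

Lemma tail_integral_small (G : T -> R) (e : R) :
  mu.-integrable setT (EFin \o G) -> 0 < e -> exists N : nat,
    mu.-integrable setT (EFin \o (fun x => if N%:R < G x then G x else 0)) /\
    \int[mu]_x (if N%:R < G x then G x else 0) <= e.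
Proof.
move=> iG e0; pose F (n : nat) x := if n%:R < G x then G x else 0.
have mG : measurable_fun setT G by apply/measurable_EFinP; exact: measurable_int iG.
have mF n : measurable_fun setT (F n).
  by apply: measurable_fun_ifT => //; apply: measurable_fun_ltr.
have iF n : mu.-integrable setT (EFin \o F n).
  apply: (le_integrable measurableT _ _ iG); first exact/measurable_EFinP.
  by move=> x _ /=; rewrite lee_fin /F; case: ifP => // _; rewrite normr0.
have F0 n x : 0 <= F n x.
  by rewrite /F; case: ifP => // nG; rewrite (le_trans _ (ltW nG)).
have Fcvg : {ae mu, forall x, setT x -> (fun n => (F n x)%:E) @ \oo --> cst 0%E x}.
  apply: aeW => x _; apply: cvg_near_cst; exists (Num.truncn (G x)).+1 => // n /= nG.
  apply/eqP; rewrite /F ltNge (_ : _ <= _)// (le_trans (ltW (truncnS_gt _)))//.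
  by rewrite ler_nat.
have FG : {ae mu, forall x n, setT x -> (`|(F n x)%:E| <= `|(G x)%:E|)%E}.
  by apply: aeW => x n _ /=; rewrite lee_fin /F; case: ifP => // _; rewrite normr0.
have [_ cvg0 _] := dominated_convergence measurableT
  (fun n => measurable_int _ (iF n)) (measurable_cst 0%E) Fcvg (integrable_abse iG) FG.
move/fine_cvg : cvg0 => /cvgrPdist_le/(_ _ e0)[N _ /(_ N (leqnn N))] /=.
rewrite sub0r normrN => FN; exists N; split; first exact: iF.
rewrite -/(F N _); apply: le_trans FN; rewrite (le_trans _ (ler_norm _))//.
rewrite le_eqVlt; apply/orP; left; apply/eqP; congr fine.
by apply: eq_integral => x _ /=; rewrite /cst subr0 ger0_norm.
Qed.

(** Where the truncation removes f, N < |f| <= G almost everywhere; so the remainder is carried by N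
    < G and bounded by G there. *)
Lemma rest_fun_norm_le f (G : T -> R) (N : R) :
  {ae mu, forall x, re `|f x| <= G x} ->
  mu.-integrable setT (EFin \o (fun x => if N < G x then G x else 0)) ->
  0 <= N ->
  fun_norm (f - truncation f N) <= \int[mu]_x (if N < G x then G x else 0).
Proof.
move=> fG iG N0; rewrite /fun_norm /Rintegral fine_le//.
- exact: integrable_fin_num (integrable_re_norm _).
- exact: integrable_fin_num iG.
apply: ae_ge0_le_integral => //.
- by move=> x _; rewrite lee_fin re_norm_ge0.
- exact: measurable_int (integrable_re_norm _).
- by move=> x _; rewrite lee_fin; case: ifP => // NG; rewrite (le_trans _ (ltW NG)).
- exact: measurable_int iG.
move: fG; apply: filterS => x fG _; rewrite lee_fin integrable_funDE integrable_funNE /=.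
case: ifPn => [_|]; first rewrite subrr normr0 re0.
  by case: ifP => // NG; rewrite (le_trans _ (ltW NG)).
by rewrite -ltNge subr0 => Nf; rewrite (lt_le_trans Nf).
Qed.

Section Martingale.
Context (y : seq bool -> L1 k mu) (M : R).
Hypothesis y_martingale : tree_martingale y.
Hypothesis y_le : forall s, rnorm (y s) <= M.

Let f s : intfun := L1_repr (y s).

(** The n-th increment of y multiplied by its sign and averaged over the words of length n. It is
    formed from representatives, so that pointwise bounds make sense. *)
Definition tree_difference n : intfun :=
  tree_avg n (fun s => 2^-1 *: (f (true :: s) - f (false :: s))) [::].

(** The mean of |y| over the descendants of s lying n levels below. *)
Let g n s x : R := tree_avg n (fun s => re `|f s x| : R^o) s.

Let gS n s x : g n.+1 s x = 2^-1 * (g n (true :: s) x + g n (false :: s) x).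
Proof. by []. Qed.

Let g0 s x : g 0 s x = re `|f s x|.
Proof. by []. Qed.

Let integrable_g n s : mu.-integrable setT (EFin \o g n s) /\ \int[mu]_x g n s x <= M.
Proof.
elim: n s => [|n ih] s; first split.
- exact: integrable_re_norm.
- by rewrite -[X in X <= _]/(fun_norm (f s)) rnorm_L1_repr.
have [i1 M1] := ih (true :: s); have [i2 M2] := ih (false :: s).
have i12 : mu.-integrable setT (EFin \o (fun x => g n (true :: s) x + g n (false :: s) x)).
  exact: (integrableD measurableT i1 i2).
split; first exact: (integrableZl measurableT 2^-1 i12).
rewrite (_ : \int[mu]_x _ = \int[mu]_x (2^-1 * (g n (true :: s) x + g n (false :: s) x)))//.
by rewrite (RintegralZl 2^-1 measurableT i12) (RintegralD measurableT i1 i2); lra.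
Qed.

Let g_ge0 n s x : 0 <= g n s x.
Proof.
elim: n s => [|n ih] s; first exact: re_norm_ge0.
by rewrite gS mulr_ge0 ?invr_ge0// addr_ge0.
Qed.

Let re_half_le (a b : K) : re `|2^-1 * (a + b)| <= 2^-1 * (re `|a| + re `|b|).
Proof.
rewrite -[X in `|X|]/(2^-1 *: (a + b)) -/(rnorm _) rnorm_half ler_wpM2l ?invr_ge0//.
exact: rnormD.
Qed.

(** The martingale identity holds between classes, so between representatives only almost
    everywhere. The triangle inequality then compares neighbouring levels. *)
Let g_nd n s : {ae mu, forall x, g n s x <= g n.+1 s x}.
Proof.
elim: n s => [|n ih] s.
  have : {ae mu, forall x, f s x = (2^-1 *: (f (true :: s) + f (false :: s))) x}.
    by apply/L1_classP; rewrite L1_classZ L1_classD !L1_reprK -y_martingale.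
  apply: filterS => x fx; rewrite gS !g0 fx integrable_funZE integrable_funDE.
  exact: re_half_le.
have := ih (false :: s); have := ih (true :: s); apply: filterS2 => x g1 g2.
by rewrite (gS n.+1) (gS n) ler_wpM2l ?invr_ge0// lerD.
Qed.

(** [tree_difference] started at an arbitrary word, as the induction requires. *)
Let difference n s : intfun :=
  tree_avg n (fun s => 2^-1 *: (f (true :: s) - f (false :: s))) s.

Let difference_le n s x : re `|difference n s x| <= g n.+1 s x.
Proof.
elim: n s => [|n ih] s.
  have -> : difference 0 s = 2^-1 *: (f (true :: s) - f (false :: s)) by [].
  rewrite gS !g0 integrable_funZE integrable_funDE integrable_funNE.
  by rewrite (le_trans (re_half_le _ _))// normrN.
have -> : difference n.+1 s =
  2^-1 *: (difference n (true :: s) + difference n (false :: s)) by [].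
rewrite gS integrable_funZE integrable_funDE (le_trans (re_half_le _ _))//.
by rewrite ler_wpM2l ?invr_ge0// lerD//; exact: ih.
Qed.

Lemma tree_difference_dominated : exists2 G : T -> R,
  mu.-integrable setT (EFin \o G) &
  forall n, {ae mu, forall x, re `|tree_difference n x| <= G x}.
Proof.
(* The lower limit is defined everywhere and subject to Fatou's lemma; at almost every x the means
   increase, and there it is their supremum. *)
pose F x := limn_einf (fun n => (g n [::] x)%:E).
have mg n : measurable_fun setT (fun x => (g n [::] x)%:E).
  exact: measurable_int (integrable_g n [::]).1.
have mF : measurable_fun setT F.
  apply: measurableT_comp => //; apply: measurable_fun_limn_esup => n.
  exact: measurableT_comp.
have F0 x : (0 <= F x)%E.
  rewrite /F limn_einf_lim; apply: lime_ge; first exact: is_cvg_einfs.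
  by apply: nearW => n; apply: le_ereal_inf_tmp => _ [m _ <-]; rewrite lee_fin.
have FM : (\int[mu]_x F x <= M%:E)%E.
  apply: le_trans (fatou mu measurableT mg _) _; first by move=> n x _; rewrite lee_fin.
  rewrite limn_einf_lim; apply: lime_le; first exact: is_cvg_einfs.
  apply: nearW => n; apply: (@le_trans _ _ (\int[mu]_x (g n [::] x)%:E)%E).
    by apply: ereal_inf_lbound; exists n => /=.
  by rewrite integral_EFin ?lee_fin; have [] := integrable_g n [::].
have iF : mu.-integrable setT F.
  apply/integrableP; split => //.
  by under eq_integral do rewrite gee0_abs//; exact: le_lt_trans FM (ltry _).
exists (fine \o F).
  apply: (le_integrable measurableT _ _ iF).
    by apply/measurable_EFinP; exact: measurableT_comp mF.
  by move=> x _ /=; case: (F x) => [r| |] //=; rewrite ?normr0 leey.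
have g_all : {ae mu, forall x, forall n, g n [::] x <= g n.+1 [::] x}.
  by apply: ae_foralln => n; exact: g_nd.
move=> n; have := integrable_ae measurableT iF; move: g_all; apply: filterS2.
move=> x gx /(_ I) Ffin; rewrite (le_trans (difference_le n [::] x))//.
rewrite -lee_fin /= fineK//.
have nd : nondecreasing_seq (fun n => (g n [::] x)%:E).
  by apply/nondecreasing_seqP => m; rewrite lee_fin.
rewrite /F (cvg_limn_einf_sup (ereal_nondecreasing_cvgn nd)).1.
by apply: ereal_sup_ubound; exists n.+1.
Qed.

End Martingale.
End AnyMeasure.

(** Truncate at a level N. The part above N is small in L1 uniformly in n, thanks to G; the part
    below has an L2 bound t not depending on n, so the factor 2^-n makes its contribution small. *)
Lemma dominated_small (mu : {finite_measure set T -> \bar R})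
    (h : nat -> @integrable_fun R k d T mu -> R) (C : R)
    (r : nat -> @integrable_fun R k d T mu) (G : T -> R) :
  (forall n, real_linear (h n)) ->
  (forall n f, `|h n f| <= C * fun_norm f) ->
  (forall n (f : @integrable_fun R k d T mu) (t : R), 0 < t ->
    fun_bounded f -> square_integral f <= t ^+ 2 ->
    h n f <= 2^-1 ^+ n * t) ->
  mu.-integrable setT (EFin \o G) ->
  (forall n, {ae mu, forall x, re `|r n x| <= G x}) ->
  forall e : R, 0 < e -> exists n, h n (r n) <= e.
Proof.
move=> hl hC hs iG rG e e0.
have C1 : 0 < `|C| + 1 by rewrite ltr_wpDl.
(* Half of e is for the part above the truncation level; adding 1 keeps the divisor positive. *)
have e20 : 0 < e / 2 / (`|C| + 1) by rewrite !divr_gt0.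
have [N [iGN GN]] := tail_integral_small iG e20.
pose m := fine (mu setT).
have m0 : 0 <= m by rewrite fine_ge0.
(* Chosen positive and with N^2 m <= t^2, as the truncation is bounded by N and m is the total
   mass. *)
pose t := (N%:R + 1) * (m + 1).
have t0 : 0 < t by rewrite mulr_gt0// ltr_wpDl.
have e2 : 0 < e / 2 by rewrite divr_gt0.
have [n /(_ n (leqnn n)) nt] := geometric_small t e2.
exists n; pose f := truncation (r n) N%:R.
have fN x : re `|f x| <= N%:R by rewrite /f /=; case: ifP => // _; rewrite normr0 re0.
have bf : fun_bounded f by exists N%:R; exact: fN.
have ft : square_integral f <= t ^+ 2.
  have iN := finite_measure_integrable_cst mu (N%:R ^+ 2 : R) measurableT.
  apply: (@le_trans _ _ (\int[mu]_x (cst (N%:R ^+ 2) x : R))).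
    apply: le_Rintegral => //; first exact: square_integrable.
    by move=> x _; rewrite ler_pXn2r ?nnegrE ?re_norm_ge0.
  rewrite Rintegral_cst// -/m /t exprMn.
  have m1 : m <= (m + 1) ^+ 2 by rewrite sqrrD mulr1 expr1n; have := sqr_ge0 m; lra.
  by rewrite ler_pM ?sqr_ge0// ler_pXn2r ?nnegrE ?addr_ge0// lerDl.
have := hs n f t t0 bf ft.
have : h n (r n - f) <= e / 2.
  rewrite (le_trans (ler_norm _))// (le_trans (hC _ _))//.
  have := rest_fun_norm_le (rG n) iGN (ler0n _ _) => /le_trans/(_ GN) restle.
  apply: (@le_trans _ _ ((`|C| + 1) * fun_norm (r n - f))).
    by rewrite ler_wpM2r ?fun_norm_ge0// (le_trans (ler_norm _))// lerDl.
  by rewrite -ler_pdivlMl// mulrC.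
by rewrite real_linearB// [2^-1 ^+ n * _]mulrC; lra.
Qed.

End Domination.

(** * The copy of c0 and the sign martingale in c0 *)

Section C0Copies.
Context {R : realType} {k : scalar_kind}.
Local Notation K := (scalars R k).

Lemma c0_coordinate_le (a : c0 R k) i : re `|a i| <= rnorm a.
Proof.
have a_bounded : bounded_on setT a.
  have := c0_seqP a; rewrite inE => a0.
  have /cvg_seq_bounded/pinfty_ex_gt0 : cvgn a by apply/cvg_ex; exists 0.
  by move=> [M _ aM]; exists M => j _; exact: aM.
rewrite -(@ler_of_real R k) -normE of_real_re_norm.
exact: (ler_supnorm a_bounded).
Qed.

Lemma c0_norm_le (a : c0 R k) (M : R) : (forall i, re `|a i| <= M) -> rnorm a <= M.
Proof.
move=> aM; rewrite -(@ler_of_real R k) -normE; apply: supnorm_le; first by exists 0%N.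
by move=> i _; rewrite -[leLHS]of_real_re_norm ler_of_real.
Qed.

Lemma interval_indicator_c0 (m n : nat) :
  (fun i => if (m <= i < n)%N then 1 else 0 : K) \in @c0_pred R k.
Proof.
rewrite inE; apply: cvg_near_cst; exists n => // i /= ni.
by rewrite [(i < n)%N]ltnNge ni andbF.
Qed.

Definition interval_indicator m n : c0 R k := C0 (interval_indicator_c0 m n).

Lemma continuous_linear_bounded_op (V W : normedModType K) (f : {linear V -> W}) :
  continuous f -> bounded_op f.
Proof.
move=> /linear_bounded_continuous/linear_boundedP/pinfty_ex_gt0[M _ fM].
by exists M.
Qed.

(** The real parts of the coordinates, defined on the copy of c0, are extended to E by
    Hahn-Banach. *)
Lemma c0_copy (E : normedModType K) (F : linear_subspace E) :
  isomorphic (c0 R k) (subspace_type F) ->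
  exists2 J : {linear c0 R k -> E}, bounded_op J &
    exists2 C : R, 0 <= C & exists phi : nat -> E -> R, forall i,
      [/\ real_linear (phi i), forall x, `|phi i x| <= C * rnorm x &
        forall a, phi i (J a) = re (a i)].
Proof.
move=> [f [g [fK gK cf cg]]].
have [B B0 fB] := bounded_op_rnorm (continuous_linear_bounded_op cf).
have [C C0 gC] := bounded_op_rnorm (continuous_linear_bounded_op cg).
pose j (a : c0 R k) : E := val (f a).
have jl : linear j by move=> t a b; rewrite /j linearP.
pose J : {linear c0 R k -> E} := HB.pack j (GRing.isLinear.Build _ _ _ _ _ jl).
exists J.
  exists (of_real B) => a; rewrite [`|J a|]normE [`|a|]normE -of_realM ler_of_real.
  exact: fB.
exists C => //.
have ext i : exists phi : E -> R, [/\ real_linear phi,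
    forall x, phi x <= C * rnorm x & forall a, phi (J a) = re (a i)].
  (* Domination holds since the real part of a i is at most the norm of a = g (f a), and C bounds
     g. *)
  have [|phi [phil phile phiE]] := @Hahn_Banach R k E C
      [set p | exists a : c0 R k, p = (j a, re (a i))] C0.
    split.
    - by exists 0; rewrite /j linear0 /= re0.
    - move=> t _ _ _ _ [a [-> ->]] [b [-> ->]]; exists (of_real t *: a + b).
      rewrite jl; congr (_, _).
      by rewrite [RHS]reD reM of_realK im_of_real mul0r subr0.
    - move=> _ _ [a [-> ->]]; rewrite (le_trans (le_re_norm _))//.
      by rewrite (le_trans (c0_coordinate_le _ _))// -{1}[a]fK; exact: gC.
  by exists phi; split => // a; apply: phiE; exists a.
have [phi phiP] := choice ext.
exists phi => i; have [phil phile phiE] := phiP i; split => // x.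
by rewrite ler_norml phile andbT lerNl -(real_linearN phil) -(rnormN x).
Qed.

End C0Copies.

Section SignTree.
Context {R : realType} {k : scalar_kind}.
Local Notation K := (scalars R k).
Variables N M : nat -> nat.
Hypothesis NM : forall n, (N n <= N n.+1)%N && (M n <= N n.+1)%N.

(** The letter added at level n chooses the sign of the indicator of [N n, M n); by [NM] these
    intervals are disjoint. *)
Fixpoint sign_tree (s : seq bool) : c0 R k :=
  if s is b :: s' then
    sign_tree s' + (if b then 1 else -1 : K) *:
      @interval_indicator R k (N (size s')) (M (size s'))
  else 0.

Lemma sign_treeE b s i : sign_tree (b :: s) i = sign_tree s i +
  (if b then 1 else -1) * (if (N (size s) <= i < M (size s))%N then 1 else 0).
Proof. by []. Qed.

Lemma sign_tree_martingale : tree_martingale sign_tree.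
Proof.
by move=> s; rewrite /= scale1r scaleN1r addrACA subrr addr0 half_sum.
Qed.

Lemma sign_tree_difference s :
  2^-1 *: (sign_tree (true :: s) - sign_tree (false :: s)) =
  interval_indicator (N (size s)) (M (size s)).
Proof.
rewrite /= scale1r scaleN1r opprD opprK addrACA subrr add0r.
exact: half_sum.
Qed.

Lemma sign_tree_norm s : rnorm (sign_tree s) <= 1.
Proof.
apply: c0_norm_le => i.
(* The induction also records that coordinates from [N (size s)] on are still 0, so that each
   coordinate changes at most once. *)
suff : re `|sign_tree s i| <= 1 /\ ((N (size s) <= i)%N -> sign_tree s i = 0) by case.
elim: s => [|b s [ih1 ih2]]; first by rewrite /= normr0 re0.
have /andP[N1 M1] := NM (size s).
rewrite sign_treeE.
split => [|Ni].
  have [/andP[/ih2 -> _]|_] := boolP (N (size s) <= i < M (size s))%N; last first.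
    by rewrite mulr0 addr0.
  by rewrite add0r mulr1; case: b; rewrite ?normrN normr1 -of_real1 of_realK.
rewrite ih2 ?(leq_trans N1)// [(i < _)%N]ltnNge (leq_trans M1 Ni) andbF.
by rewrite mulr0 addr0.
Qed.

End SignTree.

(** * Assembling the contradiction *)

Lemma L1_class_tree_avg (R : realType) (k : scalar_kind) (d : measure_display)
    (T : measurableType d) (mu : {measure set T -> \bar R})
    n (z : seq bool -> @integrable_fun R k d T mu) s :
  L1_class (tree_avg n z s) = tree_avg n (fun s => L1_class (z s)) s.
Proof. by elim: n s => //= n ih s; rewrite L1_classZ L1_classD !ih. Qed.

Theorem proposition2p2 (R : realType) (k : scalar_kind)
    (d : measure_display) (T : measurableType d)
    (mu : {finite_measure set T -> \bar R})
    (E : completeNormedModType (scalars R k))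
    (E_c0 : exists F : linear_subspace E,
      closed [set x : E | x \in subspace_pred F] /\
      isomorphic (c0 R k) (subspace_type F))
    (Q : {linear L1 k mu -> E})
    (Q_bounded : bounded_op Q)
    (Q_surj : forall y : E, exists x : L1 k mu, Q x = y) :
  ~ complemented (range (@bidual_embed R k (subspace_type (kernel_of Q)))).
Proof.
move=> compl.
have [F [_ /c0_copy[J /bounded_op_rnorm[B B0 JB] [C C0 [phi phiP]]]]] := E_c0.
have [A A0 QA] := bounded_op_rnorm Q_bounded.
have [D D0 lift] := open_mapping (@L1_rcomplete R k d T mu)
  (@completeNormedMod_rcomplete R k E) Q_bounded Q_surj.
(* The extended coordinate functionals, pulled back along Q to integrable functions. *)
pose psi i (f : @integrable_fun R k d T mu) : R := phi i (Q (L1_class f)).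
have psi_linear i : real_linear (psi i).
  by move=> t f g; have [phil _ _] := phiP i; rewrite /psi L1_classD L1_classZ linearP phil.
have psi_le i f : `|psi i f| <= C * A * fun_norm f.
  have [_ phile _] := phiP i; rewrite (le_trans (phile _))// -mulrA ler_wpM2l//.
  by rewrite -rnorm_L1_class.
(* The pair p holds the index n, which sets the tolerance 2^-n, and the position after which the
   blocks start. *)
have blocks (p : nat * nat) : exists uv : {poly R} * {poly R},
    [/\ convex_block p.2 uv.1, convex_block (size uv.1) uv.2 &
      forall f r, 0 < r -> fun_bounded f -> square_integral f <= r ^+ 2 ->
        combination psi (uv.1 - uv.2) f <= 2^-1 ^+ p.1 * r].
  have e0 : 0 < 2^-1 ^+ p.1 :> R by rewrite exprn_gt0// invr_gt0.
  have [u [v uvP]] := small_blocks psi_linear psi_le p.2 e0.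
  by exists (u, v).
have [uv uvP] := choice blocks.
(* The blocks of stage n + 1 start beyond both blocks of stage n. The interval [N n, M n) contains
   the support of [u n] and ends before that of [v n]. *)
pose fix N n := if n is m.+1 then
  (N m + size (uv (m, N m)).1 + size (uv (m, N m)).2)%N else 0%N.
pose u n := (uv (n, N n)).1; pose v n := (uv (n, N n)).2.
pose M n := size (u n).
have NM n : (N n <= N n.+1)%N && (M n <= N n.+1)%N.
  by rewrite /= -addnA leq_addr addnCA -/(u n) leq_addr.
(* The open mapping theorem lifts the sign martingale term by term; D * B is a uniform bound as its
   terms have norm at most 1 in c0. *)
have /choice[z zP] : forall s, exists x : L1 k mu,
    Q x = J (sign_tree N M s) /\ rnorm x <= D * B.
  move=> s; have [x Qx xle] := lift (J (sign_tree N M s)); exists x; split => //.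
  rewrite (le_trans xle)// ler_wpM2l// (le_trans (JB _))// ler_piMr//.
  exact: sign_tree_norm.
have Qz_martingale : tree_martingale (fun s => Q (z s)).
  move=> s; rewrite (zP s).1 (zP (true :: s)).1 (zP (false :: s)).1.
  by rewrite {1}(sign_tree_martingale N M s) linearZ linearD.
have [A' [y [y_martingale y_le Qy]]] :=
  martingale_lift compl (fun s => (zP s).2) Qz_martingale.
have [G iG dG] := tree_difference_dominated y_martingale y_le.
(* Small for the L2 norm, but shown below to take the value 1 at the n-th averaged difference, while
   domination makes some value at most 1/2. *)
pose h n := combination psi (u n - v n).
have h_linear n : real_linear (h n) by exact: combination_linear.
have h_le n f : `|h n f| <= 2 * (C * A) * fun_norm f.
  have [cu cv _] := uvP (n, N n).
  rewrite /h /combination coef_pairB (le_trans (ler_normB _ _))//.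
  rewrite -mulrA mulr_natl mulr2n lerD//.
    by apply: (coef_pair_convex cu) => i; exact: psi_le.
  by apply: (coef_pair_convex cv) => i; exact: psi_le.
have h_small n f t : 0 < t -> fun_bounded f -> square_integral f <= t ^+ 2 ->
    h n f <= 2^-1 ^+ n * t.
  by have [_ _] := uvP (n, N n); apply.
have half_gt0 : 0 < 2^-1 :> R by rewrite invr_gt0.
have [n] := dominated_small h_linear h_le h_small iG dG half_gt0.
suff -> : h n (tree_difference y n) = 1 by lra.
(* Q maps the half difference at a word s of length n to the image of the indicator of [N n, M n),
   which is the same for all such s and is unchanged by averaging. *)
have Qdiff : Q (L1_class (tree_difference y n)) = J (interval_indicator (N n) (M n)).
  rewrite L1_class_tree_avg tree_avg_linear.
  rewrite (@tree_avg_eq _ _ _ _ (fun s => J (interval_indicator (N (size s)) (M (size s))))).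
    exact: (tree_avg_level n (fun m => J (interval_indicator (N m) (M m)))).
  move=> s; rewrite -scaleN1r L1_classZ L1_classD L1_classZ scaleN1r !L1_reprK.
  rewrite linearZ linearB/= !Qy (zP (true :: s)).1 (zP (false :: s)).1.
  by rewrite -linearB -linearZ sign_tree_difference.
have psi_diff i : psi i (tree_difference y n) = (N n <= i < M n)%N%:R.
  have [_ _ phiE] := phiP i; rewrite /psi Qdiff phiE /=.
  by case: ifP => _; rewrite ?re0// -of_real1 of_realK.
have [[_ u1 uN] [_ _ vM] _] := uvP (n, N n).
rewrite /h /combination (_ : psi^~ _ = fun i => (N n <= i < M n)%N%:R); last first.
  by apply/funext => i; exact: psi_diff.
(* The coefficients of [v n] vanish below M n and the indicator vanishes from M n on. On the support
   of [u n] the indicator is 1, which leaves the coefficient sum [(u n).[1]]. *)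
rewrite coef_pairB (_ : coef_pair _ (v n) = 0) ?subr0; last first.
  rewrite /coef_pair big1// => i _; have [iM|Mi] := ltnP i (M n).
    by rewrite vM// mul0r.
  by rewrite andbF mulr0.
rewrite -[RHS]u1 horner_coef; apply: eq_bigr => i _.
have [iN|Ni] := ltnP i (N n); first by rewrite uN// !mul0r.
by rewrite /M /u ltn_ord expr1n.
Qed.
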